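(* Let $W$ be a finite Coxeter group. Let $\Pi_W^{(2)}$ be the poset, ordered by inclusion, of those parabolic subgroups of $W$ all of whose irreducible components have even rank. Then: (1) $\Pi_W^{(2)}$ is pure, with rank function $\mathrm{rk}_{\Pi_W^{(2)}}(W')=\frac{\mathrm{rk}(W')}{2}$. (2) If $W$ is irreducible of even rank, then $\Pi_W^{(2)}$ is semimodular; if $W$ is irreducible of odd rank, then $\Pi_W^{(2)}\cup\{\hat 1\}$ is semimodular. (3) $\Pi_W^{(2)}$ is Cohen--Macaulay.
   Context: A parabolic subgroup of a finite Coxeter group $W$ is any $W$-conjugate of a standard parabolic subgroup; equivalently, in the (essential) reflection representation $V$ over $\mathbb{R}$, the pointwise stabilizer of a subspace of $V$. All parabolic subgroups are allowed, not only those standard with respect to a chosen Coxeter system. The rank $\mathrm{rk}(W')$ of a parabolic subgroup $W'$ is its rank as a Coxeter group, i.e. $\dim V-\dim V^{W'}$. The trivial subgroup has no irreducible components and is the minimum element $\hat 0$ of $\Pi_W^{(2)}$. A finite poset is pure if all its maximal chains have the same length; the rank of an element $x$ of a pure poset with minimum $\hat 0$ is the length of any maximal chain of $[\hat 0,x]$. In (2), $\Pi_W^{(2)}\cup\{\hat 1\}$ denotes $\Pi_W^{(2)}$ with a new maximum element $\hat 1$ adjoined. A finite poset with minimum and maximum is semimodular if, whenever two distinct elements $x,y$ both cover an element $z$, there is an element covering both $x$ and $y$. A finite poset $P$ is Cohen--Macaulay if its order complex $\Delta(P)$ (the simplicial complex of chains) is Cohen--Macaulay over $\mathbb{Z}$: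 for every face $F$ of $\Delta(P)$ (including the empty face), $\tilde H_i(\mathrm{link}_{\Delta(P)}(F);\mathbb{Z})=0$ for all $i<\dim \mathrm{link}_{\Delta(P)}(F)$. *)

(* Defs.v *)
From HB Require Import structures.
From mathcomp Require Import all_boot all_order all_fingroup all_algebra.

Set Implicit Arguments.
Unset Strict Implicit.
Unset Printing Implicit Defensive.

Import Order.TTheory GroupScope.

Section FinitePosets.
Local Open Scope order_scope.
Context {d : Order.disp_t}.

Definition is_chain (P : finPOrderType d) (C : {set P}) : bool :=
  [forall x in C, forall y in C, x >=< y].

Definition maximal_chain (P : finPOrderType d) (A C : {set P}) : bool :=
  maxset (fun D : {set P} => is_chain D && (D \subset A)) C.

Definition chain_length (P : finPOrderType d) (C : {set P}) : nat := #|C|.-1.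

Definition pure_poset (P : finPOrderType d) : Prop :=
  forall C D : {set P}, maximal_chain setT C -> maximal_chain setT D ->
    chain_length C = chain_length D.

Definition has_poset_rank (P : finBPOrderType d) (x : P) (r : nat) : Prop :=
  forall C : {set P}, maximal_chain [set y | \bot <= y <= x] C ->
    chain_length C = r.

Definition covered_by (P : finPOrderType d) (x y : P) : bool :=
  (x < y) && ~~ [exists z, x < z < y].

Definition semimodular (P : finPOrderType d) : Prop :=
  [/\ exists b : P, forall x, b <= x,
      exists t : P, forall x, x <= t
    & forall x y z : P, x != y -> covered_by z x -> covered_by z y ->
        exists w : P, covered_by x w /\ covered_by y w].

(* The empty chain is a face. *)
Definition order_complex (P : finPOrderType d) : {set {set P}} :=
  [set C | is_chain C].

End FinitePosets.

(* P with a new maximum element, None, adjoined. *)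
Definition with_top (P : Type) := option P.

Section WithTop.
Context {d : Order.disp_t} (P : finPOrderType d).
Local Open Scope order_scope.

Definition with_top_le (x y : with_top P) : bool :=
  match x, y with
  | _, None => true
  | None, Some _ => false
  | Some a, Some b => a <= b
  end.

Lemma with_top_le_refl : reflexive with_top_le.
Proof. by case=> //= a. Qed.

Lemma with_top_le_anti : antisymmetric with_top_le.
Proof. by case=> [a|] [b|] //= /le_anti->. Qed.

Lemma with_top_le_trans : transitive with_top_le.
Proof. by case=> [a|] [b|] [c|] //=; apply: le_trans. Qed.

HB.instance Definition _ := Finite.on (with_top P).
HB.instance Definition _ := Order.Le_isPOrder.Build d (with_top P)
  with_top_le_refl with_top_le_anti with_top_le_trans.
End WithTop.

(* A simplicial complex on a finite vertex type V is given by its set of faces,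
   the empty face included.  Chains and homology groups are indexed by the
   cardinality n of faces, so that index n is homological degree n - 1 and
   index 0 is the augmentation degree -1 of reduced homology. *)
Section SimplicialComplexes.
Context {V : finType}.
Implicit Types (K : {set {set V}}) (F G : {set V}) (c : {ffun {set V} -> int}).
Local Open Scope ring_scope.

Definition link K F : {set {set V}} :=
  [set G : {set V} | [disjoint G & F] && ((G :|: F)%SET \in K)].

(* dim K + 1 *)
Definition max_face_card K : nat := (\max_(G in K) #|G|)%N.

Definition simplicial_chain K (n : nat) c : Prop :=
  forall G, c G != 0 -> (G \in K) && (#|G| == n)%N.

(* Faces are oriented by the enumeration order of V: the coefficient of G in
   the boundary of the face v |: G is (-1)^i, where v has i predecessors in G. *)
Definition boundary c : {ffun {set V} -> int} :=
  [ffun G : {set V} => \sum_(v | v \notin G)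
     (-1) ^+ #|[set u in G | (enum_rank u < enum_rank v)%N]| * c (v |: G)%SET].

Definition reduced_homology_vanishes K (n : nat) : Prop :=
  forall c, simplicial_chain K n c -> boundary c = 0 ->
    exists2 b, simplicial_chain K n.+1 b & boundary b = c.

Definition cohen_macaulay_complex K : Prop :=
  forall F, F \in K -> forall n : nat, (n < max_face_card (link K F))%N ->
    reduced_homology_vanishes (link K F) n.

End SimplicialComplexes.

Definition cohen_macaulay d (P : finPOrderType d) : Prop :=
  cohen_macaulay_complex (order_complex P).

Section CoxeterGroups.
Context {gT : finGroupType}.
Implicit Types (W P : {group gT}) (S I : {set gT}).

(* W is presented by the generators S and the relations (s t) ^ m(s, t) = 1
   with m(s, t) the order of s t; the presentation is expressed by its
   universal property. *)
Definition coxeter_system W S : Prop :=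
  [/\ <<S>> = W,
      forall s, s \in S -> #[s] = 2
    & forall (H : groupType) (f : gT -> H),
        (forall s t, s \in S -> t \in S -> (f s * f t) ^+ #[s * t] = 1) ->
        exists g : gT -> H,
          {in W &, {morph g : x y / x * y}} /\ {in S, g =1 f}].

(* Edges of the Coxeter graph on I: s and t are joined when m(s, t) >= 3. *)
Definition coxeter_edge I : rel gT :=
  [rel s t | [&& s \in I, t \in I & 2 < #[s * t]]].

(* The K in coxeter_components I are the simple systems of the irreducible
   components of the standard parabolic subgroup <<I>>. *)
Definition coxeter_components I : {set {set gT}} :=
  equivalence_partition (connect (coxeter_edge I)) I.

Definition coxeter_irreducible S : bool := #|coxeter_components S| == 1%N.

(* P is a W-conjugate of the standard parabolic subgroup <<I>>. *)
Definition parabolic_with_type W S P I : bool :=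
  (I \subset S) && ((P : {set gT}) \in <<I>> :^: W).

Definition has_parabolic_rank W S P (r : nat) : Prop :=
  exists2 I, parabolic_with_type W S P I & #|I| = r.

Definition even_parabolic W S P : bool :=
  [exists I : {set gT}, parabolic_with_type W S P I &&
     [forall K in coxeter_components I, ~~ odd #|K|]].

End CoxeterGroups.

Fact inclusion_display : Order.disp_t. Proof. exact: Order.Disp tt tt. Qed.

Section EvenParabolicPoset.
Context {gT : finGroupType} (W : {group gT}) (S : {set gT}).

Record even_parabolic_poset := EvenParabolic {
  even_parabolic_val :> {group gT};
  _ : even_parabolic W S even_parabolic_val }.

HB.instance Definition _ := [isSub for even_parabolic_val].
HB.instance Definition _ := [Finite of even_parabolic_poset by <:].

Definition even_parabolic_le (P Q : even_parabolic_poset) : bool := P \subset Q.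

Lemma even_parabolic_le_refl : reflexive even_parabolic_le.
Proof. by move=> P; apply: subxx. Qed.

Lemma even_parabolic_le_anti : antisymmetric even_parabolic_le.
Proof. by move=> P Q PQ; apply/val_inj/group_inj/eqP; rewrite eqEsubset. Qed.

Lemma even_parabolic_le_trans : transitive even_parabolic_le.
Proof. by move=> Q P R; apply: subset_trans. Qed.

HB.instance Definition _ :=
  Order.Le_isPOrder.Build inclusion_display even_parabolic_poset
    even_parabolic_le_refl even_parabolic_le_anti even_parabolic_le_trans.

Lemma even_parabolic1 : even_parabolic W S 1%G.
Proof.
apply/existsP; exists set0; rewrite /parabolic_with_type sub0set gen0 /=.
apply/andP; split; first by apply/imsetP; exists 1; rewrite // conjsg1.
by apply/forall_inP=> K /imsetP[x]; rewrite inE.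
Qed.

Lemma even_parabolic_le1 (P : even_parabolic_poset) :
  (EvenParabolic even_parabolic1 <= P)%O.
Proof. exact: sub1G. Qed.

HB.instance Definition _ :=
  Order.hasBottom.Build inclusion_display even_parabolic_poset
    even_parabolic_le1.

End EvenParabolicPoset.

(* Main.v *)
Require Import Defs.
From mathcomp Require Import all_boot all_order all_fingroup all_algebra.
From mathcomp Require Import cyclic zify.

(* Parabolic subgroups are controlled by the inversion cocycle eta of (W, S),
   which the universal property of the presentation supplies through an action
   of W on gT * bool.  Minimal double coset representatives show that a
   parabolic subgroup contained in a standard one <<J>> is <<I>> up to
   conjugation in <<J>>, with I a subset of J, and walking down from the longest
   element puts a parabolic subgroup and a reflection inside a parabolic subgroup
   of rank at most one more.

   A set of generators is even when all its subsets closed under adjacency in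
   the Coxeter graph have even size.  Adding one generator to an even set I
   creates exactly one odd component; if this is not a whole component of S, a
   further generator adjacent to it makes the set even again.  So covers raise
   the rank by 2, inside one irreducible component of W (the color of the cover),
   and two covers a, b of z have a common cover unless they have the same color
   and are maximal in it.

   For Cohen-Macaulayness, let F be a chain above z, and let Q_A be the set of
   elements outside F, comparable with F, and above some member of a set A of
   covers of z.  Removing a from A, the order complex of Q_A is the union of that
   of Q_(A - a) and of the cone with apex a, and these meet in the complex of the
   same kind given by the covers of a lying above some member of A - a; so
   Mayer-Vietoris applies inductively.  When W is reducible this only works for
   suitable A, singled out by the predicate [good]. *)

Set Implicit Arguments.
Unset Strict Implicit.
Unset Printing Implicit Defensive.

(** * Homology of simplicial complexes *)

Section Homology.
Import GRing.Theory Num.Theory.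
Variable V : finType.
Implicit Types (K : {set {set V}}) (F G H : {set V}) (c : {ffun {set V} -> int}).
Local Open Scope ring_scope.

Definition face_sign G (v : V) : int :=
  (-1) ^+ #|[set u in G | (enum_rank u < enum_rank v)%N]|.

Lemma face_signU1 H (a v : V) : a \notin H ->
  face_sign (a |: H)%SET v = (-1) ^+ (enum_rank a < enum_rank v)%N * face_sign H v.
Proof.
move=> aH; rewrite /face_sign -exprD; congr (_ ^+ _).
rewrite (cardsD1 a) !inE eqxx /=; congr (_ + _)%N.
apply: eq_card => u; rewrite !inE.
by case: eqVneq => [->|//]; rewrite (negPf aH).
Qed.

Lemma face_sign_sq G v : face_sign G v * face_sign G v = 1.
Proof. by rewrite /face_sign -expr2 sqrr_sign. Qed.

(** Of [u] and [v], exactly one precedes the other, so exactly one of the two products acquires an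
    extra sign. This is what makes the boundary square to zero. *)
Lemma face_sign_swap H (u v : V) : u != v -> u \notin H -> v \notin H ->
  face_sign H u * face_sign (u |: H)%SET v =
  - (face_sign H v * face_sign (v |: H)%SET u).
Proof.
move=> uv uH vH; rewrite !face_signU1 //.
rewrite -(inj_eq (@enum_rank_inj _)) -val_eqE /= in uv.
by case: ltngtP uv => // _ _;
  rewrite expr0 expr1 mul1r mulN1r mulrN ?opprK mulrC.
Qed.

Lemma boundaryE c G :
  boundary c G = \sum_(v | v \notin G) face_sign G v * c (v |: G)%SET.
Proof. by rewrite ffunE. Qed.

Lemma boundaryD c c' : boundary (c + c') = boundary c + boundary c'.
Proof.
apply/ffunP=> G; rewrite !(ffunE, boundaryE) -big_split /=.
by apply: eq_bigr => v _; rewrite ffunE mulrDr.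
Qed.

Lemma boundaryN c : boundary (- c) = - boundary c.
Proof.
apply/ffunP=> G; rewrite !(ffunE, boundaryE) -sumrN /=.
by apply: eq_bigr => v _; rewrite ffunE mulrN.
Qed.

Lemma boundaryB c c' : boundary (c - c') = boundary c - boundary c'.
Proof. by rewrite boundaryD boundaryN. Qed.

Lemma boundary_boundary c : boundary (boundary c) = 0.
Proof.
apply/ffunP=> G; rewrite boundaryE [RHS]ffunE.
pose f u v := face_sign G v * (face_sign (v |: G)%SET u * c (u |: (v |: G))%SET).
pose X := \sum_(v | v \notin G) \sum_(u | u \notin (v |: G)%SET) f u v.
have -> : \sum_(v | v \notin G) face_sign G v * boundary c (v |: G)%SET = X.
  by apply: eq_bigr => v _; rewrite boundaryE mulr_sumr.
(* Exchanging the two added vertices flips the sign of every term, so [X = - X], and [int] has no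
   2-torsion. *)
suff : X = - X by move/eqP; rewrite -addr_eq0 -mulr2n mulrn_eq0 /= => /eqP.
rewrite {1}/X (exchange_big_dep (fun u => u \notin G)) /=; last first.
  by move=> v u _; rewrite !inE negb_or => /andP[].
rewrite /X -sumrN; apply: eq_bigr => v vG; rewrite -sumrN.
apply: eq_big => u; first by rewrite !inE !negb_or vG eq_sym andbT andbC.
rewrite !inE negb_or => /and3P[uG vu _].
rewrite /f [v |: _]setUCA !mulrA -mulNr; congr (_ * _).
by apply: face_sign_swap; rewrite // eq_sym.
Qed.

Definition subcomplex_closed K :=
  forall F G, G \in K -> F \subset G -> F \in K.

Lemma chain_boundary K n c : subcomplex_closed K ->
  simplicial_chain K n.+1 c -> simplicial_chain K n (boundary c).
Proof.
move=> clK cK G; rewrite boundaryE => nz.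
have [v vG cv] : exists2 v, v \notin G & c (v |: G)%SET != 0.
  apply/exists_inP; apply: contraNT nz; rewrite negb_exists_in => /forall_inP h.
  by apply/eqP; apply: big1 => v /h; rewrite negbK => /eqP ->; rewrite mulr0.
have /andP[GK] := cK _ cv; rewrite cardsU1 vG eqSS => ->.
by rewrite (clK _ _ GK) // subsetUr.
Qed.

(** The bounding chain is the cone with apex [a] over the part of [c] away from [a]. On faces
    through [a] its boundary is right because [c] is a cycle. *)
Lemma cone_homology K a n : (forall G, G \in K -> (a |: G)%SET \in K) ->
  reduced_homology_vanishes K n.
Proof.
move=> apex c cK cyc.
pose b := [ffun G : {set V} =>
  if a \in G then face_sign (G :\ a)%SET a * c (G :\ a)%SET else 0].
exists b.
  move=> G; rewrite ffunE; case: ifP => [aG|]; last by rewrite eqxx.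
  rewrite mulf_eq0 negb_or => /andP[_ /cK /andP[/apex + /eqP <-]].
  by rewrite setD1K // (cardsD1 a) aG => ->; rewrite eqxx.
apply/ffunP=> G; rewrite boundaryE.
have [aG|aG] := boolP (a \in G); last first.
  rewrite (bigD1 a) //= big1 ?addr0 => [|v /andP[vG va]].
    by rewrite ffunE setU11 setU1K // mulrA face_sign_sq mul1r.
  by rewrite ffunE !inE eq_sym (negPf va) (negPf aG) mulr0.
(* With [G] written as [a |: H], the cycle equation of [c] at [H] expresses [c G] through the other
   faces [v |: H]. *)
have [H aH GE] : exists2 H : {set V}, a \notin H & G = (a |: H)%SET.
  by exists (G :\ a); rewrite ?setD11 ?setD1K.
have /eqP := congr1 (fun x : {ffun {set V} -> int} => x H) cyc.
rewrite boundaryE ffunE (bigD1 a) //= -GE addrC addr_eq0 => /eqP E.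
transitivity (- (face_sign H a * \sum_(v | (v \notin H) && (v != a))
    face_sign H v * c (v |: H)%SET)); last first.
  by rewrite E mulrN opprK mulrA face_sign_sq mul1r.
rewrite mulr_sumr -sumrN; apply: eq_big => v.
  by rewrite GE !inE negb_or andbC.
rewrite [in X in X -> _]GE !inE negb_or => /andP[va vH].
rewrite ffunE setU1r //.
have -> : (v |: G) :\ a = v |: H.
  apply/setP=> u; rewrite GE !inE; case: (eqVneq u a) => //= ->.
  by rewrite eq_sym (negPf va) (negPf aH).
rewrite GE -mulN1r !mulrA; congr (_ * _); rewrite mulN1r.
have -> : face_sign (a |: H) v =
    - (face_sign H a * (face_sign H v * face_sign (v |: H)%SET a)).
  have av : a != v by rewrite eq_sym.
  by rewrite -mulrN -(face_sign_swap av aH vH) mulrA face_sign_sq mul1r.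
move: (face_sign_sq (v |: H) a); move: (face_sign _ a) => z zz.
by rewrite !mulNr -!mulrA zz mulr1.
Qed.

(** Split the cycle as [c1 + c2] along the two complexes. The boundary of [c1] is a cycle of the
    intersection and bounds some [b] there, so [c1 - b] and [c2 + b] are cycles that can be filled
    separately. *)
Lemma mayer_vietoris (K1 K2 : {set {set V}}) n :
  subcomplex_closed K1 -> subcomplex_closed K2 ->
  reduced_homology_vanishes K1 n.+1 -> reduced_homology_vanishes K2 n.+1 ->
  reduced_homology_vanishes (K1 :&: K2) n ->
  reduced_homology_vanishes (K1 :|: K2) n.+1.
Proof.
move=> cl1 cl2 van1 van2 van12 c cK cyc.
pose c1 := [ffun G : {set V} => if G \in K1 then c G else 0].
pose c2 := c - c1.
have c1K : simplicial_chain K1 n.+1 c1.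
  move=> G; rewrite ffunE; case: ifP => [_ /cK /andP[]//|]; by rewrite eqxx.
have c2K : simplicial_chain K2 n.+1 c2.
  move=> G; rewrite !ffunE; case: ifP => [_|GK1]; rewrite ?subrr ?eqxx //.
  by rewrite subr0 => /cK; rewrite inE GK1.
have d12 : boundary c2 = - boundary c1 by rewrite boundaryB cyc sub0r.
have [] := van12 (boundary c1).
- move=> G nz; have /andP[G1 ->] := chain_boundary cl1 c1K nz.
  have /andP[] : (G \in K2) && (#|G| == n).
    by apply: (chain_boundary cl2 c2K); rewrite d12 ffunE oppr_eq0.
  by rewrite inE G1 => ->.
- exact: boundary_boundary.
move=> b bK db.
have addK K x y m : simplicial_chain K m x -> simplicial_chain K m y ->
    simplicial_chain K m (x + y).
  move=> xK yK G; rewrite ffunE; have [->|/xK //] := eqVneq (x G) 0.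
  by rewrite add0r => /yK.
have [] := van1 (c1 - b).
- apply: addK => // G; rewrite ffunE oppr_eq0 => /bK.
  by rewrite inE => /andP[/andP[-> _] ->].
- by rewrite boundaryB db subrr.
move=> e1 e1K de1; have [] := van2 (c2 + b).
- by apply: addK => // G /bK; rewrite inE => /andP[/andP[_ ->] ->].
- by rewrite boundaryD db d12 addNr.
move=> e2 e2K de2; exists (e1 + e2).
  by apply: addK => G; [move=> /e1K|move=> /e2K]; rewrite inE => /andP[-> ->]; rewrite ?orbT.
by rewrite boundaryD de1 de2 addrACA addNr addr0 addrC subrK.
Qed.

(** Index 0 is degree -1, where all chains are multiples of the empty face. This starts the argument
    where [mayer_vietoris] does not apply. *)
Lemma reduced_homology0_sub (K1 K2 : {set {set V}}) : set0 \in K1 ->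
  K1 \subset K2 -> reduced_homology_vanishes K1 0 -> reduced_homology_vanishes K2 0.
Proof.
move=> K10 /subsetP sub van c cK cyc; have [G|b bK <-] := van c _ cyc.
  by move=> /cK /andP[_ /[dup] G0 ->]; rewrite (cards0_eq (eqP G0)) K10.
by exists b => // G /bK /andP[/sub -> ->].
Qed.

End Homology.

(** * Posets graded by colors *)

Section ColorGradedPosets.
Import Order.TTheory.
Local Open Scope order_scope.
Context {d : Order.disp_t} (P : finPOrderType d).

Definition chains_in (Q : {set P}) : {set {set P}} :=
  [set G | is_chain G && (G \subset Q)].

Lemma is_chainP (F : {set P}) :
  reflect (forall x y, x \in F -> y \in F -> x >=< y) (is_chain F).
Proof.
apply: (iffP forall_inP) => [h x y xF yF | h x xF].
  by move/forall_inP: (h _ xF); apply.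
by apply/forall_inP=> y; apply: h.
Qed.

Lemma is_chainS (F G : {set P}) : F \subset G -> is_chain G -> is_chain F.
Proof.
by move=> /subsetP FG /is_chainP cG; apply/is_chainP=> x y /FG xG /FG; apply: cG.
Qed.

Lemma chains_in_closed (Q : {set P}) : subcomplex_closed (chains_in Q).
Proof.
move=> F G; rewrite !inE => /andP[cG GQ] FG.
by rewrite (is_chainS FG) //= (subset_trans FG).
Qed.

Lemma chains_inI (Q R : {set P}) :
  chains_in Q :&: chains_in R = chains_in (Q :&: R).
Proof. by apply/setP=> G; rewrite !inE subsetI; case: is_chain. Qed.

Lemma chains_in_cone (Q : {set P}) a n : a \in Q ->
  (forall y, y \in Q -> a >=< y) -> reduced_homology_vanishes (chains_in Q) n.
Proof.
move=> aQ h; apply: (@cone_homology _ _ a) => G; rewrite !inE => /andP[cG GQ].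
rewrite subUset sub1set aQ GQ !andbT; apply/is_chainP => x y.
move/subsetP in GQ; move/is_chainP in cG.
case/setU1P=> [->|xG] /setU1P[->|yG]; rewrite ?comparablexx ?h ?GQ //.
  by rewrite comparable_sym h ?GQ.
exact: cG.
Qed.

Definition comparable_to (F : {set P}) : {set P} :=
  [set y | (y \notin F) && [forall f in F, y >=< f]].

Lemma comparable_toP (F : {set P}) y :
  reflect (y \notin F /\ forall f, f \in F -> y >=< f) (y \in comparable_to F).
Proof.
by rewrite inE; apply: (iffP andP) => -[yF /forall_inP h].
Qed.

Lemma link_order_complex (F : {set P}) : is_chain F ->
  link (order_complex P) F = chains_in (comparable_to F).
Proof.
move=> cF; apply/setP=> G; rewrite !inE; apply/andP/andP=> -[].
  move=> /pred0P dis /is_chainP cGF; split.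
    by apply/is_chainP=> x y xG yG; apply: cGF; rewrite inE ?xG ?yG.
  apply/subsetP=> y yG; apply/comparable_toP; split.
    by apply/negP=> yF; move: (dis y); rewrite /= yG yF.
  by move=> f fF; apply: cGF; rewrite inE ?yG ?fF ?orbT.
move=> /is_chainP cG /subsetP GQ; split.
  by rewrite disjoint_subset; apply/subsetP=> y /GQ/comparable_toP[].
move/is_chainP in cF.
apply/is_chainP=> x y /setUP[xG|xF] /setUP[yG|yF]; [exact: cG| | |exact: cF].
  by have [_ ->] := comparable_toP _ _ (GQ _ xG).
by rewrite comparable_sym; have [_ ->] := comparable_toP _ _ (GQ _ yG).
Qed.

Context {C : finType} (rho : P -> C -> nat) (m : C -> nat).

Definition colored_cover c (z a : P) : bool :=
  (z < a) && [forall c', rho a c' == rho z c' + (c' == c)]%N.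

Lemma colored_coverP c z a :
  reflect (z < a /\ forall c', (rho a c' = rho z c' + (c' == c))%N)
    (colored_cover c z a).
Proof.
apply: (iffP andP) => -[za h]; split=> //; first by move=> c'; apply/eqP/(forallP h).
by apply/forallP=> c'; apply/eqP.
Qed.

(** The abstract input of the topological argument. For even parabolic subgroups, [rho x c] is half
    the rank of [x] inside the component [c] of [W], and [m c] bounds it. [color_join] may fail only
    for two covers of one color that fill it, whereas [color_join_below] has no exception: an upper
    bound of both covers suffices. *)
Record color_graded : Prop := ColorGraded {
  color_rank_mono : forall x y c, x <= y -> (rho x c <= rho y c)%N;
  color_rank_max : forall x c, (rho x c <= m c)%N;
  color_cover_below : forall x y, x < y ->
    exists c a, colored_cover c x a /\ a <= y;
  color_cover_exists : forall x c, (rho x c < m c)%N ->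
    exists a, colored_cover c x a;
  color_join_below : forall c c' z a b y,
    colored_cover c z a -> colored_cover c' z b -> a != b -> a <= y -> b <= y ->
    exists w, [/\ w <= y, colored_cover c' a w & colored_cover c b w];
  color_join : forall c c' z a b,
    colored_cover c z a -> colored_cover c' z b -> a != b ->
    (exists w, colored_cover c' a w /\ colored_cover c b w) \/
    (c = c' /\ rho a c = m c);
  color_join_unique : forall c c' z a b w w', c != c' ->
    colored_cover c z a -> colored_cover c' z b ->
    colored_cover c' a w -> colored_cover c b w ->
    colored_cover c' a w' -> colored_cover c b w' -> w = w' }.

Hypothesis gr : color_graded.

Definition color_rank z := (\sum_c rho z c)%N.
Definition color_corank z := (\sum_c m c - color_rank z)%N.

Lemma color_rank_cover c z a :
  colored_cover c z a -> color_rank a = (color_rank z).+1.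
Proof.
case/colored_coverP=> _ h; rewrite /color_rank (eq_bigr _ (fun c' _ => h c')).
rewrite big_split /= -addn1; congr addn; rewrite (bigD1 c) //= eqxx big1 //.
by move=> c' /negPf ->.
Qed.

Lemma color_rank_le x y : x <= y -> (color_rank x <= color_rank y)%N.
Proof. by move=> xy; apply: leq_sum => c _; apply: (color_rank_mono gr). Qed.

Lemma color_rank_lt x y : x < y -> (color_rank x < color_rank y)%N.
Proof.
move=> /(color_cover_below gr)[c [a [/color_rank_cover <-]]].
exact: color_rank_le.
Qed.

Lemma color_rank_bound x : (color_rank x <= \sum_c m c)%N.
Proof. by apply: leq_sum => c _; apply: (color_rank_max gr). Qed.

Lemma color_corank_cover c z a :
  colored_cover c z a -> color_corank z = (color_corank a).+1.
Proof.
move/color_rank_cover=> E; rewrite /color_corank E subnSK //.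
by rewrite -E color_rank_bound.
Qed.

Lemma color_corank_gt0 z : (0 < color_corank z)%N ->
  exists c, (rho z c < m c)%N.
Proof.
move=> h; apply/existsP; apply: contraTT h; rewrite negb_exists -leqNgt leqn0.
move/forallP=> h; rewrite subn_eq0; apply: leq_sum => c _.
by rewrite leqNgt; apply: h.
Qed.

Lemma chain_card b (G : {set P}) : is_chain G -> (forall x, x \in G -> b <= x) ->
  (#|G| <= (color_corank b).+1)%N.
Proof.
move=> /is_chainP cG bG; rewrite -[leqRHS]card_ord.
pose f x : 'I_(color_corank b).+1 := inord (color_rank x - color_rank b).
rewrite -(@card_in_imset _ _ f); first exact: max_card.
move=> x y xG yG /(congr1 val) /=.
rewrite !inordK ?ltnS ?leq_sub2r ?color_rank_bound // => E.
have {}E : color_rank x = color_rank y.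
  by rewrite -(subnK (color_rank_le (bG _ xG))) E subnK // color_rank_le ?bG.
by have := cG _ _ xG yG; case: comparableP => // /color_rank_lt; rewrite E ltnn.
Qed.

Lemma chain_min (F : {set P}) : is_chain F -> F != set0 ->
  exists2 f, f \in F & forall g, g \in F -> f <= g.
Proof.
move=> /is_chainP cF /set0Pn[f0 f0F].
have [f fF fmin] := arg_minnP color_rank f0F.
exists f => // g gF; have := fmin _ gF; have := cF _ _ fF gF.
by case: comparableP => // /color_rank_lt; rewrite ltnNge => /negPf->.
Qed.

(** * Filters generated by covers, and the Cohen-Macaulay property *)

Definition above (F A : {set P}) : {set P} :=
  [set y in comparable_to F | [exists a in A, a <= y]].

Lemma aboveP (F A : {set P}) y :
  reflect [/\ y \notin F, forall f, f \in F -> y >=< f & exists2 a, a \in A & a <= y]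
          (y \in above F A).
Proof.
rewrite inE; apply: (iffP andP) => [[/comparable_toP[yF h] /exists_inP[a aA ay]]|].
  by split=> //; exists a.
case=> yF h [a aA ay]; split; first exact/comparable_toP.
by apply/exists_inP; exists a.
Qed.

(** If the minimum of a nonempty chain lies above some [b], then so does the whole chain. *)
Lemma chains_in_above (F A : {set P}) a :
  chains_in (above F (a |: A)) =
  chains_in (above F A) :|: chains_in (above F [set a]).
Proof.
apply/setP=> G; rewrite in_setU !in_set; case cG: (is_chain G) => //=.
apply/idP/orP=> [/subsetP GQ|h]; last first.
  apply/subsetP=> y yG.
  have {h} : y \in above F A \/ y \in above F [set a].
    by case: h => /subsetP/(_ y yG); [left|right].
  case=> /aboveP[yF h [b bA ay]]; apply/aboveP; split=> //; exists b => //.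
    by rewrite setU1r.
  by move: bA; rewrite !inE => ->.
have [->|/(chain_min cG)[g gG gmin]] := eqVneq G set0.
  by left; rewrite sub0set.
have /aboveP[_ _ [b bA bg]] := GQ _ gG.
have sub (B : {set P}) : b \in B -> G \subset above F B.
  move=> bB; apply/subsetP=> y yG; have /aboveP[yF h _] := GQ _ yG.
  by apply/aboveP; split=> //; exists b; rewrite // (le_trans bg) ?gmin.
by case/setU1P: bA => [E|bA]; [right|left]; apply: sub; rewrite ?E ?set11.
Qed.

Lemma above_cone (F : {set P}) a n : a \notin F -> (forall f, f \in F -> a <= f) ->
  reduced_homology_vanishes (chains_in (above F [set a])) n.
Proof.
move=> aF aleF; apply: (@chains_in_cone _ a).
  apply/aboveP; split=> //; last by exists a; rewrite ?set11.
  by move=> f /aleF; apply: le_comparable.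
by move=> y /aboveP[_ _ [b /set1P -> ]]; apply: le_comparable.
Qed.

Definition upper_cover z a := [exists c, colored_cover c z a].

(* With several colors above [z], the union of the filters generated by an
   arbitrary set of covers of [z] is not highly connected; these cases are the
   ones preserved by [good_remove]. *)
Definition good z (F A : {set P}) : Prop :=
  A != set0 /\
  [\/ F != set0,
      exists c b, b \in A /\ forall a, a \in A -> colored_cover c z a = (a == b)
    | forall c, (rho z c < m c)%N -> exists2 a, a \in A & colored_cover c z a].

Definition covers_in z (F A : {set P}) :=
  forall a, a \in A -> upper_cover z a /\ forall f, f \in F -> a <= f.

Definition all_covers z (F : {set P}) : {set P} :=
  [set a | upper_cover z a && [forall f in F, a <= f]].

(** When [F] is a chain strictly above [z], a maximal chain has [color_corank z] elements above [z],
    and leaving out [F] removes [#|F|] of them. So the bound on [n] selects all degrees below the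
    top dimension. *)
Definition above_vanishes z (F A : {set P}) :=
  forall n, (n < color_corank z - #|F|)%N ->
  reduced_homology_vanishes (chains_in (above F A)) n.

(** Here [x] is the least element of [y |: F]. Producing covers below [x] instead of [y] keeps them
    below all of [F]. *)
Lemma chain_lower (F : {set P}) y : is_chain F -> (forall f, f \in F -> y >=< f) ->
  exists x, [/\ x = y \/ x \in F, x <= y & forall f, f \in F -> x <= f].
Proof.
move=> cF yF; have [F0|/(chain_min cF)[g gF gmin]] := eqVneq F set0.
  by exists y; split=> //; [left | rewrite F0 => f; rewrite inE].
have /orP[yg|gy] := yF _ gF; last by exists g; split=> //; right.
by exists y; split=> //; [left | move=> f /gmin; apply: le_trans].
Qed.

Lemma upper_cover_lt z a : upper_cover z a -> z < a.
Proof. by case/existsP=> c /andP[]. Qed.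

Lemma upper_cover_corank z a :
  upper_cover z a -> color_corank z = (color_corank a).+1.
Proof. by case/existsP=> c /color_corank_cover. Qed.

Lemma all_covers_in z F : covers_in z F (all_covers z F).
Proof. by move=> a; rewrite inE => /andP[-> /forall_inP]. Qed.

(** An element above [z] has a cover of [z] below it and below [F], by [chain_lower]. Thus links in
    the order complex are complexes of the form treated by [good_vanishes]. *)
Lemma above_all_covers z (F : {set P}) :
  is_chain F -> (forall f, f \in F -> z < f) ->
  above F (all_covers z F) = [set y in comparable_to F | z < y].
Proof.
move=> cF zF; apply/setP=> y; rewrite [RHS]inE; apply/aboveP/andP.
  move=> [yF h [a /all_covers_in[/upper_cover_lt za _] ay]].
  by split; [apply/comparable_toP | apply: lt_le_trans ay].
move=> [/comparable_toP[yF h] zy]; split=> //.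
have [x [xE xy xF]] := chain_lower cF h.
have zx : z < x by case: xE => [->//|/zF].
have [c [a [ca ax]]] := color_cover_below gr zx.
exists a; last exact: le_trans xy.
rewrite inE; apply/andP; split; first by apply/existsP; exists c.
by apply/forall_inP=> f /xF; apply: le_trans.
Qed.

Lemma all_covers_good z (F : {set P}) :
  is_chain F -> (forall f, f \in F -> z < f) -> (0 < color_corank z)%N ->
  good z F (all_covers z F).
Proof.
move=> cF zF z0; have [F0|Fn0] := eqVneq F set0; last first.
  split; last by constructor 1.
  have [f fF fmin] := chain_min cF Fn0.
  have [c [a [ca af]]] := color_cover_below gr (zF _ fF).
  apply/set0Pn; exists a; rewrite inE; apply/andP; split.
    by apply/existsP; exists c.
  by apply/forall_inP=> g /fmin; apply: le_trans.
have ex c : (rho z c < m c)%N -> exists2 a, a \in all_covers z F & colored_cover c z a.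
  case/(color_cover_exists gr)=> a ca; exists a => //.
  rewrite inE F0; apply/andP; split; first by apply/existsP; exists c.
  by apply/forall_inP=> f; rewrite inE.
split; last by constructor 3.
by have [c /ex[a aA _]] := color_corank_gt0 z0; apply/set0Pn; exists a.
Qed.

Definition next_covers a (F B : {set P}) : {set P} :=
  [set w in all_covers a F | [exists b in B, b <= w]].

Lemma next_coversP a (F B : {set P}) w :
  reflect [/\ upper_cover a w, forall f, f \in F -> w <= f & exists2 b, b \in B & b <= w]
          (w \in next_covers a F B).
Proof.
rewrite inE [w \in all_covers _ _]inE; apply: (iffP andP).
  by case=> /andP[aw /forall_inP wF] /exists_inP.
case=> aw wF /exists_inP ->; split=> //; rewrite aw; exact/forall_inP.
Qed.

Lemma next_covers_in a F B : covers_in a F (next_covers a F B).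
Proof. by move=> w /next_coversP[]. Qed.

(** If [y] lies above [a] and above another member [b] of [A], then [color_join_below] gives a
    common cover of [a] and [b] below both [y] and [F]. *)
Lemma aboveI_next z F A a : is_chain F -> covers_in z F A -> a \in A ->
  above F (A :\ a) :&: above F [set a] = above F (next_covers a F (A :\ a)).
Proof.
move=> cF covA aA; apply/setP=> y; rewrite inE; apply/andP/aboveP.
  case=> /aboveP[yF h [b /setD1P[ba bA] by_]] /aboveP[_ _ [_ /set1P -> ay]].
  split=> //; have [x [xE xy xF]] := chain_lower cF h.
  have low e : e \in A -> e <= y -> e <= x.
    by move=> eA ey; case: xE => [->//|/(proj2 (covA _ eA))].
  have [/existsP[c ca] _] := covA _ aA; have [/existsP[c' cb] _] := covA _ bA.
  have ab : a != b by rewrite eq_sym.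
  have [w [wx aw bw]] := color_join_below gr ca cb ab (low _ aA ay) (low _ bA by_).
  exists w; last exact: le_trans xy.
  apply/next_coversP; split; first by apply/existsP; exists c'.
    by move=> f /xF; apply: le_trans.
  exists b; first by rewrite !inE ba.
  by case/andP: bw => /ltW.
case=> yF h [w /next_coversP[/upper_cover_lt aw _ [b bA bw]] wy].
split; apply/aboveP; split=> //; first by exists b; rewrite ?(le_trans bw).
by exists a; rewrite ?set11 // (le_trans (ltW aw)).
Qed.

(** The element to remove depends on the case. If [F] is nonempty, any [a] works, since joins exist
    below the minimum of [F]. If some color occurs exactly once in [A], at [b], any [a] other than
    [b] works. Otherwise every color with room occurs twice, and again any [a] works. *)
Lemma good_remove z F A : is_chain F -> (forall f, f \in F -> z < f) ->
  covers_in z F A -> good z F A -> (1 < #|A|)%N ->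
  exists2 a, a \in A & good z F (A :\ a) /\
    ((0 < color_corank a)%N -> good a F (next_covers a F (A :\ a))).
Proof.
move=> cF zF covA [An0 gA] A1.
have D1n0 a : a \in A -> A :\ a != set0.
  by move=> aA; rewrite -card_gt0; move: A1; rewrite (cardsD1 a) aA.
have [F0|Fn0] := eqVneq F set0; last first.
  have /set0Pn[a aA] := An0; exists a => //; split; first by split; [apply: D1n0|constructor 1].
  move=> _; split; last by constructor 1.
  have /set0Pn[b /setD1P[ba bA]] := D1n0 _ aA.
  have [f fF fmin] := chain_min cF Fn0.
  have [/existsP[c ca] aleF] := covA _ aA; have [/existsP[c' cb] bleF] := covA _ bA.
  have ab : a != b by rewrite eq_sym.
  have [w [wx aw bw]] := color_join_below gr ca cb ab (aleF _ fF) (bleF _ fF).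
  apply/set0Pn; exists w; apply/next_coversP; split; first by apply/existsP; exists c'.
    by move=> g /fmin; apply: le_trans.
  by exists b; [rewrite !inE ba | case/andP: bw => /ltW].
have nextP a b c w : a \in A -> b \in A -> b != a -> colored_cover c a w -> b <= w ->
    w \in next_covers a F (A :\ a).
  move=> aA bA ba aw bw; apply/next_coversP; split; first by apply/existsP; exists c.
    by move=> f; rewrite F0 inE.
  by exists b; rewrite // !inE ba.
(* A color [c] with a unique representative [b] is treated first, whichever alternative of [good]
   was given. *)
have [/existsP[c /exists_inP[b bA /forall_inP hb]]|nsing] := boolP
  [exists c, exists b in A, forall a in A, colored_cover c z a == (a == b)].
  have {}hb a : a \in A -> colored_cover c z a = (a == b) by move=> /hb/eqP.
  have /set0Pn[a /setD1P[ab aA]] := D1n0 _ bA; exists a => //; split.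
    split; [exact: D1n0 | constructor 2; exists c, b; split].
      by rewrite !inE eq_sym ab.
    by move=> e /setD1P[_ /hb].
  move=> _; have cb : colored_cover c z b by rewrite hb ?eqxx.
  have [/existsP[ca cza] _] := covA _ aA.
  (* Only [b] has color [c], so [a] and [b] have different colors and their join [w] exists. It will
     be the unique next cover of color [c]. *)
  have cac : ca != c by apply: contraTneq cza => ->; rewrite hb.
  have [[w [aw bw]]|[E _]] := color_join gr cza cb ab; last by rewrite E eqxx in cac.
  have ba : b != a by rewrite eq_sym.
  have wN : w \in next_covers a F (A :\ a).
    by apply: (nextP a b c) => //; case/andP: bw => /ltW.
  split; first by apply/set0Pn; exists w.
  constructor 2; exists c, w; split=> // w' /next_coversP[_ _ [b' /setD1P[b'a b'A] b'w']].
  apply/idP/eqP=> [aw'|-> //].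
  (* Compare the color [c''] of [b'] with [c] and [ca]. If it is [c], then [b' = b] and uniqueness
     of joins applies. If it is [ca], the join of [a] and [b'] raises color [ca] beyond its value at
     [w']. Any other color would be raised by [b'] but not by [w']. *)
  have [/existsP[c'' cb'] _] := covA _ b'A.
  have [_ /(_ ca) ra] := colored_coverP _ _ _ cza.
  have [_ /(_ ca) rw] := colored_coverP _ _ _ aw'.
  have [E|c''c] := eqVneq c'' c.
    have {E} E : b' = b by apply/eqP; rewrite -hb // -E.
    apply: (color_join_unique gr cac cza cb aw' _ aw bw).
    rewrite {}E in b'w' *; apply/colored_coverP.
    have rwE c' : (rho w' c' = rho b c' + (c' == ca))%N.
      have [_ ->] := colored_coverP _ _ _ aw'; have [_ ->] := colored_coverP _ _ _ cza.
      by have [_ ->] := colored_coverP _ _ _ cb; rewrite addnAC.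
    split=> //; rewrite lt_neqAle b'w' andbT; apply: contraTneq (leqnn (rho w' ca)) => {2}<-.
    by rewrite rwE eqxx addn1 ltnn.
  have [E|c''ca] := eqVneq c'' ca.
    rewrite {}E in cb'; have ab' : a != b' by rewrite eq_sym.
    have aw'le : a <= w' by case/andP: aw' => /ltW.
    have [v [vw' av _]] := color_join_below gr cza cb' ab' aw'le b'w'.
    have [_ /(_ ca)] := colored_coverP _ _ _ av.
    have := color_rank_mono gr ca vw'; rewrite rw (negPf cac) addn0 eqxx => + E.
    by rewrite E addn1 ltnn.
  have := color_rank_mono gr c'' b'w'.
  have [_ ->] := colored_coverP _ _ _ cb'; have [_ ->] := colored_coverP _ _ _ aw'.
  have [_ ->] := colored_coverP _ _ _ cza.
  by rewrite eqxx (negPf c''c) (negPf c''ca) !addn0 addn1 ltnn.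
have {}gA c : (rho z c < m c)%N -> exists2 a, a \in A & colored_cover c z a.
  case: gA; [by rewrite F0 eqxx| | exact].
  move=> [c0 [b [bA hb]]]; case/negP: nsing; apply/existsP; exists c0.
  by apply/exists_inP; exists b => //; apply/forall_inP=> a /hb ->.
have /set0Pn[a aA] := An0; exists a => //.
(* No color is represented exactly once, so each color with room keeps a representative after [a] is
   removed. *)
have ex c : (rho z c < m c)%N -> exists2 b, b \in A :\ a & colored_cover c z b.
  move=> /gA[b bA cb]; have [E|ba] := eqVneq b a; last by exists b; rewrite // !inE ba.
  rewrite {}E in cb.
  move: nsing; rewrite negb_exists => /forallP/(_ c); rewrite negb_exists_in.
  move=> /forall_inP/(_ _ aA); rewrite negb_forall_in => /exists_inP[e eA].
  have [->|ea] := eqVneq e a; first by rewrite cb.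
  by rewrite eqbF_neg negbK => ce; exists e; rewrite // !inE ea.
split; first by split; [apply: D1n0 | constructor 3].
have [/existsP[c ca] _] := covA _ aA.
have ex' c' : (rho a c' < m c')%N ->
    exists2 w, w \in next_covers a F (A :\ a) & colored_cover c' a w.
  move=> lt; have [_ /(_ c') E] := colored_coverP _ _ _ ca.
  have [|b /setD1P[ba bA] cb] := ex c'.
    by apply: leq_ltn_trans lt; rewrite E leq_addr.
  have ab : a != b by rewrite eq_sym.
  have [[w [aw bw]]|[Ec Em]] := color_join gr ca cb ab.
    by exists w => //; apply: (nextP a b c') => //; case/andP: bw => /ltW.
  by move: lt; rewrite -Ec Em ltnn.
move=> /color_corank_gt0[c' /ex'[w wN _]]; split; last by constructor 3.
by apply/set0Pn; exists w.
Qed.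

(** Nested inductions: the outer one on [color_corank z], for the intersection, which lives above a
    cover of [z]; the inner one on [#|A|], for the removal of one cover. *)
Lemma good_vanishes z F A : is_chain F -> (forall f, f \in F -> z < f) ->
  covers_in z F A -> good z F A -> above_vanishes z F A.
Proof.
have [k] := ubnP (color_corank z); elim: k z F A => // k IHk z F A.
have [j] := ubnP #|A|; elim: j A => // j IHj A leA leZ cF zF covA gA n hn.
(* If some [a] in [A] belongs to [F], every member of [A] lies below [a] and has the same rank, so
   it equals [a]. The filter is then the one generated by all covers of [a] along [F :\ a], with the
   same bound. *)
have [/exists_inP[a aA aF]|noAF] := boolP [exists a in A, a \in F].
  have [za _] := covA _ aA; have zltF := upper_cover_lt za.
  have aF' f : f \in F :\ a -> a < f.
    move=> /setD1P[fa fF]; rewrite lt_neqAle eq_sym fa.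
    by have [_ ->] := covA _ aA.
  have cF' : is_chain (F :\ a) by apply: is_chainS cF; apply: subD1set.
  have -> : above F A = above (F :\ a) (all_covers a (F :\ a)).
    rewrite above_all_covers //; apply/setP=> y; rewrite [RHS]inE.
    apply/aboveP/andP=> [[yF h [b bA by_]]|[/comparable_toP[yF h] ay]].
      split.
        apply/comparable_toP; split=> [|f /setD1P[_ /h]//].
        by rewrite !inE (negPf yF) andbF.
      have [zb bleF] := covA _ bA.
      have E : b = a.
        have := bleF _ aF; rewrite le_eqVlt => /orP[/eqP//|/color_rank_lt].
        move: (upper_cover_corank za) (upper_cover_corank zb).
        case/existsP: za => ? /color_rank_cover ->.
        by case/existsP: zb => ? /color_rank_cover ->; rewrite ltnn.
      by rewrite lt_neqAle -{2}E by_ andbT; apply: contraNneq yF => <-.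
    split.
      by apply: contra yF => yF; rewrite !inE yF andbT; apply: contraTneq ay => ->; rewrite ltxx.
    - move=> f fF; have [->|fa] := eqVneq f a; first by rewrite ge_comparable // ltW.
      by apply: h; rewrite !inE fa.
    - by exists a; rewrite // ltW.
  have cor := upper_cover_corank za.
  have hn' : (n < color_corank a - #|F :\ a|)%N.
    by move: hn; rewrite cor (cardsD1 a F) aF add1n subSS.
  have a0 : (0 < color_corank a)%N by lia.
  apply: IHk hn' => //; first by rewrite cor ltnS in leZ.
    exact: all_covers_in.
  exact: all_covers_good.
have AF a : a \in A -> a \notin F.
  by move=> aA; apply: contra noAF => aF; apply/exists_inP; exists a.
have [A1|A1] := leqP #|A| 1.
  have [An0 _] := gA; have /cards1P[a E] : #|A| == 1%N.
    by rewrite eqn_leq A1 card_gt0.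
  have aA : a \in A by rewrite E set11.
  by rewrite E; apply: above_cone; [apply: AF | have [] := covA _ aA].
have [a aA [gAa ga]] := good_remove cF zF covA gA A1.
have [za aleF] := covA _ aA; have cor := upper_cover_corank za.
have covAa : covers_in z F (A :\ a) by move=> b /setD1P[_ /covA].
have van : above_vanishes z F (A :\ a).
  by apply: IHj => //; move: leA; rewrite (cardsD1 a) aA.
have E := chains_in_above F (A :\ a) a; rewrite setD1K // in E; rewrite {}E.
case: n hn => [|n] hn.
  apply: reduced_homology0_sub (van _ hn); last exact: subsetUl.
  by rewrite inE sub0set andbT; apply/is_chainP=> x y; rewrite inE.
apply: mayer_vietoris; [exact: chains_in_closed|exact: chains_in_closed|exact: van| |].
  by apply: above_cone => //; apply: AF.
rewrite chains_inI (aboveI_next cF covA) //.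
(* Passing from [z] to [a] lowers the corank by one, which matches the index shift in
   Mayer-Vietoris. *)
have hn' : (n < color_corank a - #|F|)%N.
  by move: hn; rewrite cor; lia.
have a0 : (0 < color_corank a)%N by lia.
apply: IHk hn' => //.
- by rewrite cor ltnS in leZ.
- by move=> f fF; rewrite lt_neqAle aleF // andbT; apply: contraNneq (AF _ aA) => ->.
- exact: next_covers_in.
- exact: ga.
Qed.

(** If [b] is not in [F], the link of [F] is a cone with apex [b]. Otherwise the link is the complex
    over all covers of [b] along [F :\ b]. *)
Lemma color_graded_cohen_macaulay (b : P) : (forall x, b <= x) ->
  cohen_macaulay P.
Proof.
move=> bot F; rewrite inE => cF n; rewrite link_order_complex //.
have [bF|bF] := boolP (b \in F); last first.
  move=> _; apply: (@chains_in_cone _ b) => [|y _]; last exact: le_comparable.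
  by apply/comparable_toP; split=> // f _; apply: le_comparable.
move=> hn.
have zF f : f \in F :\ b -> b < f.
  by rewrite !inE lt_neqAle bot eq_sym => /andP[->].
have cF' : is_chain (F :\ b) by apply: is_chainS cF; apply: subD1set.
have -> : comparable_to F = above (F :\ b) (all_covers b (F :\ b)).
  rewrite above_all_covers //; apply/setP=> y; rewrite [RHS]inE.
  apply/comparable_toP/andP=> [[yF h]|[/comparable_toP[yF h] by_]].
    split; first apply/comparable_toP.
      split=> [|f /setD1P[_ /h]//]; by rewrite !inE (negPf yF) andbF.
    by rewrite lt_neqAle bot andbT; apply: contraNneq yF => <-.
  split.
    by apply: contra yF => yF; rewrite !inE yF andbT; apply: contraTneq by_ => ->; rewrite ltxx.
  move=> f fF; have [->|fb] := eqVneq f b; first by rewrite comparable_sym le_comparable.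
  by apply: h; rewrite !inE fb.
(* A face of the link together with [F] is a chain above [b], so it has at most [color_corank b + 1]
   elements, of which [F] takes [#|F :\ b| + 1]. *)
have bnd : (n < color_corank b - #|F :\ b|)%N.
  apply: (leq_trans hn); apply/bigmax_leqP=> G.
  rewrite -(link_order_complex cF) inE => /andP[dis]; rewrite inE => cGF.
  have := chain_card cGF (fun x _ => bot x).
  rewrite cardsU (eqP (_ : G :&: F == set0)) ?setI_eq0 // cards0 subn0.
  by rewrite (cardsD1 b F) bF; lia.
have b0 : (0 < color_corank b)%N by lia.
apply: (@good_vanishes b) bnd => //; first exact: all_covers_in.
exact: all_covers_good.
Qed.

(** * Maximal chains, purity and semimodularity *)

Lemma covered_byP z a : reflect (exists c, colored_cover c z a) (covered_by z a).
Proof.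
apply: (iffP andP) => [[za nz]|[c ca]].
  have [c [a' [ca' a'a]]] := color_cover_below gr za; exists c.
  have [<- //|a'Na] := eqVneq a' a; case/negP: nz; apply/existsP; exists a'.
  by case/andP: ca' => -> _; rewrite lt_neqAle a'Na.
split; first by case/andP: ca.
apply/existsPn=> y; apply/negP=> /andP[/color_rank_lt zy /color_rank_lt].
by rewrite (color_rank_cover ca) ltnS leqNgt zy.
Qed.

(** The chain meets every rank from that of [b] to that of [x]. At a missing rank, let [y] and [y']
    be its neighbors in the chain. A cover of [y] below [y'] is comparable with the whole chain, so
    it belongs to it, contradicting the choice of [y]. *)
Lemma saturated_chain_card (C0 : {set P}) b x : is_chain C0 ->
  b \in C0 -> x \in C0 -> (forall e, e \in C0 -> b <= e <= x) ->
  (forall a, b <= a <= x -> is_chain (a |: C0) -> a \in C0) ->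
  #|C0| = (color_rank x - color_rank b).+1.
Proof.
move=> cC bC xC bnd sat; have /is_chainP cmp := cC.
have rkC e : e \in C0 -> (color_rank b <= color_rank e <= color_rank x)%N.
  by move=> /bnd/andP[be ex]; rewrite !color_rank_le.
have lt_of e e' : e \in C0 -> e' \in C0 -> (color_rank e < color_rank e')%N -> e < e'.
  move=> eC e'C lt; have := cmp _ _ eC e'C; case: comparableP => //.
    by move=> /color_rank_lt; rewrite ltnNge ltnW.
  by move=> E; rewrite E ltnn in lt.
have le_of e e' : e \in C0 -> e' \in C0 -> (color_rank e <= color_rank e')%N -> e <= e'.
  move=> eC e'C le; have := cmp _ _ eC e'C; case: comparableP => //.
  by move=> /color_rank_lt; rewrite ltnNge le.
have hit r : (color_rank b <= r <= color_rank x)%N ->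
    exists2 e, e \in C0 & color_rank e = r.
  move=> /andP[br rx]; pose A := [pred e in C0 | (color_rank e <= r)%N].
  have Ab : A b by rewrite /= bC.
  have [y /andP[yC yr] ymax] := arg_maxnP color_rank Ab.
  have [->|yNr] := eqVneq r (color_rank y); first by exists y.
  have {yNr} yr' : (color_rank y < r)%N by rewrite ltn_neqAle eq_sym yNr.
  have [E|rNx] := eqVneq r (color_rank x); first by exists x.
  pose B := [pred e in C0 | (r < color_rank e)%N].
  have Bx : B x by rewrite /= xC ltn_neqAle rNx.
  have [y' /andP[y'C ry'] y'min] := arg_minnP color_rank Bx.
  have yy' : y < y' by apply: lt_of => //; apply: ltn_trans ry'.
  have [c [a [ca ay']]] := color_cover_below gr yy'.
  have ya : y < a by case/andP: ca.
  have aC : a \in C0.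
    apply: sat.
      have /andP[by_ _] := bnd _ yC; have /andP[_ y'x] := bnd _ y'C.
      by rewrite (le_trans by_ (ltW ya)) (le_trans ay').
    have acmp e : e \in C0 -> e >=< a.
      move=> eC; have [er|re] := leqP (color_rank e) r.
        apply/le_comparable/(le_trans _ (ltW ya))/le_of => //.
        by apply: ymax; rewrite /= eC.
      apply/ge_comparable/(le_trans ay')/le_of => //.
      by apply: y'min; rewrite /= eC.
    apply/is_chainP=> e e' /setU1P[->|eC] /setU1P[->|e'C]; rewrite ?comparablexx //.
    - by rewrite comparable_sym acmp.
    - exact: acmp.
    - exact: cmp.
  have := ymax a; rewrite /= aC (color_rank_cover ca) => /(_ yr').
  by rewrite ltnn.
pose f e : 'I_(color_rank x - color_rank b).+1 := inord (color_rank e - color_rank b).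
have fE e : e \in C0 -> f e = color_rank e - color_rank b :> nat.
  by move=> /rkC/andP[be ex]; rewrite inordK // ltnS leq_sub2r.
have finj : {in C0 &, injective f}.
  move=> e e' eC e'C /(congr1 val) /=; rewrite !fE // => E.
  have {}E : color_rank e = color_rank e'.
    by move: (rkC _ eC) (rkC _ e'C); lia.
  by apply/le_anti; rewrite !le_of ?E.
rewrite -(card_in_imset finj) -[RHS]card_ord; apply: eq_card => i.
rewrite [RHS]inE; have ix := ltn_ord i.
have bx : (color_rank b <= color_rank x)%N by have /andP[] := rkC _ bC.
have [|e eC er] := hit (i + color_rank b)%N; first by lia.
by apply/imsetP; exists e => //; apply: val_inj; rewrite /= fE // er addnK.
Qed.

Lemma maximal_chainP (A C0 : {set P}) : maximal_chain A C0 ->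
  [/\ is_chain C0, C0 \subset A &
      forall a, a \in A -> is_chain (a |: C0) -> a \in C0].
Proof.
case/maxsetP=> /andP[cC CA] mx; split=> // a aA caC.
rewrite -(mx (a |: C0)) ?setU11 ?subsetUr //.
by rewrite caC subUset sub1set aA.
Qed.

Lemma is_chainU1 (C0 : {set P}) a : is_chain C0 ->
  (forall e, e \in C0 -> a >=< e) -> is_chain (a |: C0).
Proof.
move=> /is_chainP cC ha; apply/is_chainP=> e e' /setU1P[->|eC] /setU1P[->|e'C];
  rewrite ?comparablexx ?ha //; last exact: cC.
by rewrite comparable_sym ha.
Qed.

Lemma maximal_chain_interval_card b x (C0 : {set P}) : b <= x ->
  maximal_chain [set y | b <= y <= x] C0 ->
  #|C0| = (color_rank x - color_rank b).+1.
Proof.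
move=> bx /maximal_chainP[cC /subsetP CA sat].
have bnd e : e \in C0 -> b <= e <= x by move=> /CA; rewrite inE.
apply: saturated_chain_card => //.
- apply: sat; first by rewrite inE lexx.
  by apply: is_chainU1 => // e /bnd/andP[/le_comparable].
- apply: sat; first by rewrite inE lexx andbT.
  by apply: is_chainU1 => // e /bnd/andP[_ /ge_comparable].
- by move=> a h; apply: sat; rewrite inE.
Qed.

Lemma maximal_chain_card b (C0 : {set P}) : (forall x, b <= x) ->
  maximal_chain setT C0 -> #|C0| = (color_corank b).+1.
Proof.
move=> bot /maximal_chainP[cC _ sat].
have bC : b \in C0.
  by apply: sat => //; apply: is_chainU1 => // e _; apply: le_comparable.
have [x xC xmax] := arg_maxnP color_rank bC.
have top e : e \in C0 -> e <= x.
  move=> eC; have /is_chainP/(_ _ _ eC xC) := cC; case: comparableP => //.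
  by move=> /color_rank_lt; rewrite ltnNge => /negP[]; apply: xmax.
(* A color with room at the top of the chain would provide a cover extending it. *)
have x0 : color_corank x = 0%N.
  apply/eqP; rewrite -leqn0 leqNgt; apply/negP=> /color_corank_gt0[c].
  case/(color_cover_exists gr)=> a ca; have xa : x < a by case/andP: ca.
  suff /top ax : a \in C0 by rewrite (le_gtF ax) in xa.
  apply: sat => //; apply: is_chainU1 => // e /top ex.
  by apply/ge_comparable/(le_trans ex)/ltW.
rewrite (@saturated_chain_card _ b x) //.
- by move: x0 (color_rank_bound x); rewrite /color_corank; lia.
- by move=> e eC; rewrite bot top.
- by move=> a _; apply: sat.
Qed.

Lemma color_graded_pure (b : P) : (forall x, b <= x) -> pure_poset P.
Proof.
by move=> bot C1 C2 h1 h2; rewrite /chain_length !(maximal_chain_card bot).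
Qed.

Lemma color_graded_semimodular (b t : P) : (forall x, b <= x) -> (forall x, x <= t) ->
  semimodular P.
Proof.
move=> bot top; split; [by exists b|by exists t|].
move=> x y z xy /covered_byP[c cx] /covered_byP[c' cy].
have [w [_ xw yw]] := color_join_below gr cx cy xy (top x) (top y).
by exists w; split; apply/covered_byP; [exists c'|exists c].
Qed.

Lemma lt_Some (x y : P) : ((Some x : with_top P) < Some y) = (x < y).
Proof. by rewrite !lt_neqAle. Qed.

Lemma lt_None (x : P) : (Some x : with_top P) < None.
Proof. by rewrite lt_neqAle. Qed.

Lemma covered_by_Some (x y : P) :
  covered_by (Some x : with_top P) (Some y) = covered_by x y.
Proof.
rewrite /covered_by lt_Some; congr (_ && ~~ _).
apply/existsP/existsP => [[[e|] h]|[e h]].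
- by exists e; rewrite !lt_Some in h.
- by case/andP: h => _ /ltW.
- by exists (Some e); rewrite !lt_Some.
Qed.

Lemma covered_by_None (x : P) :
  covered_by (Some x : with_top P) None = (color_corank x == 0%N).
Proof.
rewrite /covered_by lt_None; apply/idP/idP.
  apply: contraNT; rewrite -lt0n => /color_corank_gt0[c].
  case/(color_cover_exists gr)=> a /andP[xa _]; apply/existsP.
  by exists (Some a); rewrite lt_Some xa lt_None.
move=> /eqP x0; apply/existsPn=> -[e|]; last by rewrite ltxx andbF.
rewrite lt_Some lt_None andbT; apply/negP=> /color_rank_lt.
by move: x0 (color_rank_bound e); rewrite /color_corank; lia.
Qed.

Lemma color_graded_with_top_semimodular (b : P) c0 : (forall x, b <= x) ->
  (forall c, c != c0 -> m c = 0%N) -> semimodular (with_top P).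
Proof.
move=> bot mono; split; [by exists (Some b) => -[x|]; [apply: (bot x)|] | by exists None; case|].
(* Only [c0] has room, so an element that fills the color of its cover has corank zero and is
   covered by [None]. This handles the exceptional case of [color_join]. *)
have top_of c z a : colored_cover c z a -> rho a c = m c -> color_corank a = 0%N.
  move=> /colored_coverP[_ E] am.
  have cc0 : c = c0.
    by apply/eqP; apply: contraPT am => /mono ->; rewrite E eqxx addn1.
  apply/eqP; rewrite subn_eq0; apply: leq_sum => c' _.
  by have [->|/mono ->//] := eqVneq c' c0; rewrite -cc0 am.
move=> [a|] [e|] [z|] // ae; rewrite ?covered_by_Some ?covered_by_None.
- move=> /covered_byP[c ca] /covered_byP[c' ce].
  have [[w [aw ew]]|[E am]] := color_join gr ca ce ae.
    by exists (Some w); rewrite !covered_by_Some; split; apply/covered_byP; [exists c'|exists c].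
  exists None; rewrite !covered_by_None (top_of c z) // (top_of c z e) ?E //.
  move: am; case/colored_coverP: ca => _ ->; case/colored_coverP: ce => _ ->.
  by rewrite E.
- by move=> /covered_byP[c /color_corank_cover ->].
- by move=> /eqP z0 /covered_byP[c /color_corank_cover]; rewrite z0.
Qed.

End ColorGradedPosets.

(** * The inversion cocycle *)

Section ReflectionCocycle.
Import GroupScope.
Context {gT : finGroupType}.
Implicit Types (S I J : {set gT}) (eta : gT -> gT -> bool).

(** For a reflection [x], [eta w x] says that the wall of [x] separates 1 from [w], or equivalently
    that [x * w] is shorter than [w]. The second clause says that the walls crossed by [u * v] are
    those crossed by [u] and the translates of those crossed by [v], counted modulo 2. *)
Definition reflection_cocycle S eta : Prop :=
  [/\ forall s, s \in S -> #[s] = 2,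
      forall u v x, u \in <<S>> -> v \in <<S>> ->
        eta (u * v) x = eta u x (+) eta v (x ^ u)
    & forall s x, s \in S -> eta s x = (x == s)].

Lemma reflection_cocycleS S I eta :
  I \subset S -> reflection_cocycle S eta -> reflection_cocycle I eta.
Proof.
move=> IS [inv mul gen]; have /subsetP WIS := genS IS; have /subsetP sIS := IS.
by split=> [s /sIS /inv|u v x /WIS uW /WIS vW|s x /sIS /gen] //; apply: mul.
Qed.

Section Construction.

(* A pair [(x, e)] stands for a reflection [x] and a side [e] of its wall. *)
Definition flip_fun (s : gT) (p : gT * bool) := (p.1 ^ s, p.2 (+) (p.1 == s)).

Lemma flip_fun_inj s : injective (flip_fun s).
Proof.
move=> [x e] [y e'] /= [/conjg_inj -> h]; congr (_, _).
exact: addIb h.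
Qed.

Definition flip s : {perm gT * bool} := perm (@flip_fun_inj s).

Lemma flipE s p : flip s p = (p.1 ^ s, p.2 (+) (p.1 == s)).
Proof. by rewrite permE. Qed.

(** The alternating word for [(s * t) ^+ n] crosses in turn the walls of [(s * t) ^+ j * s] for
    [j < n.*2], and the bit counts modulo 2 how often [x] occurs among them. *)
Lemma flip_mul_exp (s t : gT) n x e : #[s] = 2 -> #[t] = 2 ->
  ((flip s * flip t) ^+ n) (x, e) =
  (x ^ ((s * t) ^+ n), e (+) \big[addb/false]_(j < n.*2) (x == (s * t) ^+ j * s)).
Proof.
move=> s2 t2.
have ss : s * s = 1 by rewrite -(expg_order s) s2.
have tt : t * t = 1 by rewrite -(expg_order t) t2.
have sV : s^-1 = s by apply/eqP; rewrite eq_invg_mul ss.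
have tV : t^-1 = t by apply/eqP; rewrite eq_invg_mul tt.
set r := s * t.
have rs : r ^ s = r^-1 by rewrite /r conjgE invMg sV tV !mulgA ss mul1g.
have comm k : r ^+ k * s = s * r ^- k.
  by rewrite -[r ^- k]expgVn -rs -conjXg conjgE sV !mulgA ss mul1g.
have eqJ (a b y : gT) : (y ^ a == b) = (y == b ^ a^-1).
  by rewrite -[RHS](inj_eq (conjg_inj a)) conjgKV.
elim: n => [|n IHn]; first by rewrite !expg0 perm1 big_ord0 conjg1 addbF.
rewrite expgSr permM {}IHn permM !flipE /= -!conjgM !mulgA.
rewrite -(mulgA _ s t) -/r -expgSr; congr (_, _).
rewrite doubleS !big_ord_recr /= -!addbA; congr (_ (+) (_ (+) _)).
rewrite !eqJ; congr (addb _ _); congr (_ == _).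
  by rewrite conjgE invgK -addnn expgD -mulgA comm mulgA.
rewrite conjgE invgK invMg sV !mulgA -addnn -addnS expgD expgS.
by rewrite -(mulgA _ s t) -/r -[LHS]mulgA -comm !mulgA.
Qed.

(** For [n] the order of [s * t], the indices [j] and [j + n] give the same reflection, so each wall
    is crossed an even number of times. *)
Lemma flip_relation (s t : gT) : #[s] = 2 -> #[t] = 2 ->
  (flip s * flip t) ^+ #[s * t] = 1.
Proof.
move=> s2 t2; apply/permP=> -[x e]; rewrite flip_mul_exp // perm1.
rewrite expg_order conjg1 -addnn big_split_ord /= (eq_bigr (fun j : 'I_#[s * t] => x == (s * t) ^+ j * s)) //.
rewrite [X in _ (+) (_ (+) X)](eq_bigr (fun j : 'I_#[s * t] => x == (s * t) ^+ j * s)).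
  by rewrite addbb addbF.
by move=> j _; rewrite expgD expg_order mul1g.
Qed.

(** The flips satisfy the defining relations, so they extend to an action of [W] on [gT * bool].
    Read off on the second coordinate, its multiplicativity is the cocycle rule. *)
Lemma coxeter_cocycle (W : {group gT}) S : coxeter_system W S ->
  exists eta, reflection_cocycle S eta.
Proof.
case=> genS ord univ.
have [|g [gM gS]] := univ {perm gT * bool} flip.
  by move=> s t sS tS; apply: flip_relation; apply: ord.
pose eta w x := (g w (x, false)).2.
have g1 : g 1 = 1.
  by apply: (mulgI (g 1)); rewrite -gM ?group1 // !mulg1.
have gE w : w \in W -> forall x e, g w (x, e) = (x ^ w, e (+) eta w x).
  rewrite -genS => /gen_prodgP[n [c cS ->]].
  have cW k (i : 'I_k -> gT) : (forall j, i j \in S) -> \prod_(j < k) i j \in W.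
    by move=> iS; apply: group_prod => j _; rewrite -genS mem_gen.
  elim: n c cS => [|n IHn] c cS x e.
    by rewrite big_ord0 /eta g1 !perm1 conjg1 addbF.
  have pW : \prod_(i < n) c (lift ord0 i) \in W by apply: cW.
  have c0W : c ord0 \in W by rewrite -genS mem_gen.
  rewrite big_ord_recl /eta gM // !permM (gS (c ord0)) // !flipE /=.
  by rewrite !IHn //= conjgM addbA.
exists eta; split=> // [u v x|s x sS]; last by rewrite /eta gS ?flipE.
by rewrite genS => uW vW; rewrite {1}/eta gM // permM gE // gE.
Qed.

End Construction.
End ReflectionCocycle.

(** * Length function and exchange condition *)

Section Length.
Import GroupScope.
Context {gT : finGroupType} (eta : gT -> gT -> bool).
Implicit Types (S I J L : {set gT}).

Definition inversions (w : gT) : {set gT} := [set x | eta w x].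
(* The word length of [w], by [len_word] and [word_len]. *)
Definition len w := #|inversions w|.

Lemma conjgg (x : gT) : x ^ x = x.
Proof. by rewrite conjgE mulKg. Qed.

Section Cocycle.
Variable S : {set gT}.
Hypothesis hS : reflection_cocycle S eta.

Lemma gen_sqr s : s \in S -> s * s = 1.
Proof. by case: hS => h _ _ /h s2; rewrite -(expg_order s) s2. Qed.

Lemma gen_neq1 s : s \in S -> s != 1.
Proof. by case: hS => h _ _ /h; apply: contra_eqN => /eqP->; rewrite order1. Qed.

Lemma cocycleM u v x : u \in <<S>> -> v \in <<S>> ->
  eta (u * v) x = eta u x (+) eta v (x ^ u).
Proof. by case: hS => _ h _; apply: h. Qed.

Lemma cocycle_gen s x : s \in S -> eta s x = (x == s).
Proof. by case: hS => _ _ h; apply: h. Qed.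

Lemma cocycle1 x : eta 1 x = false.
Proof. by have := cocycleM x (group1 _) (group1 _); rewrite mulg1 conjg1 addbb. Qed.

Lemma gen_ind (Q : gT -> Prop) : Q 1 ->
  (forall s w, s \in S -> w \in <<S>> -> Q w -> Q (s * w)) ->
  forall w, w \in <<S>> -> Q w.
Proof.
move=> Q1 QM w /gen_prodgP[n [c cS ->]]; elim: n c cS => [|n IHn] c cS.
  by rewrite big_ord0.
rewrite big_ord_recl; apply: QM; [exact: cS | | exact: IHn].
by apply: group_prod => j _; apply: mem_gen.
Qed.

Lemma cocycleV w x : w \in <<S>> -> eta w^-1 x = eta w (x ^ w^-1).
Proof.
move=> wS; have wVS : w^-1 \in <<S>> by rewrite groupV.
have := cocycleM (x ^ w^-1) wS wVS.
by rewrite mulgV cocycle1 conjgKV; do 2!case: eta.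
Qed.

Lemma inversionsM u v : u \in <<S>> -> v \in <<S>> ->
  inversions (u * v) =
  (inversions u :\: inversions v :^ u^-1) :|: (inversions v :^ u^-1 :\: inversions u).
Proof.
move=> uS vS; apply/setP=> x; rewrite !inE mem_conjg invgK inE cocycleM //.
by do 2!case: eta.
Qed.

Lemma lenV w : w \in <<S>> -> len w^-1 = len w.
Proof.
move=> wS; rewrite /len -(cardJg (inversions w) w); apply: eq_card => x.
by rewrite mem_conjg !inE cocycleV.
Qed.

Lemma lenM u v : u \in <<S>> -> v \in <<S>> -> (len (u * v) <= len u + len v)%N.
Proof.
move=> uS vS; rewrite /len inversionsM // -(cardJg (inversions v) u^-1).
apply: leq_trans (leq_card_setU _ _) _.
by apply: leq_add; apply/subset_leq_card/subsetDl.
Qed.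

Lemma len1 : len 1 = 0%N.
Proof. by apply/eqP; rewrite cards_eq0; apply/eqP/setP=> x; rewrite !inE cocycle1. Qed.

Lemma len_gen s : s \in S -> len s = 1%N.
Proof.
move=> sS; rewrite -(cards1 s); apply: eq_card => x.
by rewrite !inE cocycle_gen.
Qed.

(** The inversions of [s * w] are those of [w] conjugated by [s], with membership of [s] itself
    toggled. *)
Lemma len_genM s w : s \in S -> w \in <<S>> ->
  if eta w s then len w = (len (s * w)).+1 else len (s * w) = (len w).+1.
Proof.
move=> sS wS; have sG : s \in <<S>> by apply: mem_gen.
have E x : (x \in inversions (s * w)) = (x == s) (+) (x \in inversions w :^ s^-1).
  by rewrite inE cocycleM // cocycle_gen // mem_conjg invgK inE.
have sE : (s \in inversions w :^ s^-1) = eta w s by rewrite mem_conjg invgK inE conjgg.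
rewrite /len -!(cardJg (inversions w) s^-1); case: ifP => sw.
  rewrite (cardsD1 s (_ :^ _)) sE sw; congr _.+1; apply: eq_card => x.
  by rewrite in_setD1 E; case: eqVneq => [->|]; rewrite ?sE ?sw.
rewrite (cardsD1 s (inversions _)) E eqxx sE sw; congr _.+1; apply: eq_card => x.
by rewrite in_setD1 E; case: eqVneq => [->|]; rewrite ?sE ?sw.
Qed.

(** Strong exchange condition: multiplying by [x] deletes the first letter at which the word crosses
    the wall of [x]. *)
Lemma exchange n w x : w \in S ^+ n -> eta w x ->
  exists2 k, n = k.+1 & x * w \in S ^+ k.
Proof.
have sub k : {subset S ^+ k <= <<S>>}.
  elim: k => [|k IHk] y; first by rewrite expg0 => /set1P ->.
  by rewrite expgS => /mulsgP[s v sS /IHk vS ->]; rewrite groupM // mem_gen.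
elim: n w x => [|n IHn] w x.
  by rewrite expg0 => /set1P ->; rewrite cocycle1.
rewrite expgS => /mulsgP[s v sS vS ->].
have sG := mem_gen sS; have vG := sub _ _ vS.
rewrite cocycleM // cocycle_gen //.
case: eqVneq => [-> _|_ /=]; first by exists n; rewrite // mulgA gen_sqr ?mul1g.
case/(IHn _ _ vS)=> k -> vk; exists k.+1 => //.
rewrite mulgA (conjgC x s) -mulgA expgS; exact: mem_mulg.
Qed.

Lemma len_word w : w \in <<S>> -> w \in S ^+ len w.
Proof.
elim/gen_ind=> [|s v sS vG IH]; first by rewrite len1 expg0 set11.
have := len_genM sS vG; case: ifP => [sv E|_ ->]; last first.
  by rewrite expgS; apply: mem_mulg.
by have [k] := exchange IH sv; rewrite E => -[->].
Qed.

Lemma word_len n w : w \in S ^+ n -> w \in <<S>> /\ (len w <= n)%N.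
Proof.
elim: n w => [|n IHn] w; first by rewrite expg0 => /set1P ->; rewrite len1 group1.
rewrite expgS => /mulsgP[s v sS /IHn[vG lv] ->]; have sG := mem_gen sS.
rewrite groupM //; split=> //; apply: leq_trans (lenM _ _) _ => //.
by rewrite len_gen.
Qed.

Lemma len0 w : w \in <<S>> -> len w = 0%N -> w = 1.
Proof. by move=> /len_word + E; rewrite E expg0 => /set1P. Qed.

Lemma len1_gen w : w \in <<S>> -> len w = 1%N -> w \in S.
Proof. by move=> /len_word + E; rewrite E expg1. Qed.

Lemma exchange_len w x : w \in <<S>> -> eta w x -> x * w \in <<S>> /\ (len (x * w) < len w)%N.
Proof. by move=> /len_word ww /(exchange ww)[k -> /word_len]. Qed.

Lemma inversion_in w x : w \in <<S>> -> eta w x -> x \in <<S>>.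
Proof. by move=> wG /exchange_len[] // ; rewrite groupMr. Qed.

Lemma exists_descent w : w \in <<S>> -> w != 1 -> exists2 s, s \in S & eta w s.
Proof.
move=> wG w1; have := len_word wG.
case E: (len w) => [|n]; first by rewrite (len0 wG) ?eqxx in w1.
rewrite expgS => /mulsgP[s v sS /word_len[vG lv] wE]; exists s => //.
have sG := mem_gen sS; rewrite wE cocycleM // cocycle_gen // eqxx conjgg.
have := len_genM sS vG; rewrite -wE E; case: eta => // h.
by rewrite h ltnNge leqnSn in lv.
Qed.

(** For [t = s ^ u] the contributions of [u^-1] and [u] cancel, leaving [eta s s]. *)
Lemma cocycle_refl t : t \in class_support S <<S>> -> eta t t.
Proof.
case/imset2P=> s u sS uG ->; have sG := mem_gen sS; have uVG : u^-1 \in <<S>> by rewrite groupV.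
rewrite {1}conjgE cocycleM ?groupM // cocycleV // conjgK cocycleM //.
by rewrite (cocycle_gen _ sS) eqxx conjgg; case: eta.
Qed.

Lemma refl_in t : t \in class_support S <<S>> -> t \in <<S>>.
Proof. by case/imset2P=> s u sS uG ->; rewrite groupJ // mem_gen. Qed.

End Cocycle.

(** * Coset representatives, inclusions and joins of parabolic subgroups *)

Section Parabolic.
Variable S : {set gT}.
Hypothesis hS : reflection_cocycle S eta.

(** The hypothesis on [d] expresses that it is the shortest element of its coset [<<I>> d].
    Inversions of [u] lie in [<<I>>], whereas the conjugated inversions of [d] avoid it, so none
    cancel. *)
Lemma len_addM I u d : I \subset S -> u \in <<I>> -> d \in <<S>> ->
  (forall x, x \in <<I>> -> ~~ eta d x) -> len (u * d) = (len u + len d)%N.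
Proof.
move=> IS uI dS hd; have uS := subsetP (genS IS) _ uI.
rewrite /len (inversionsM hS) // -(cardJg (inversions d) u^-1).
have dis : [disjoint inversions u & inversions d :^ u^-1].
  rewrite disjoint_subset; apply/subsetP=> x; rewrite inE => ux.
  have xI := inversion_in (reflection_cocycleS IS hS) uI ux.
  by rewrite !inE mem_conjg invgK inE hd // groupJ.
have := dis; rewrite disjoint_sym => dis'.
rewrite (setDidPl dis) (setDidPl dis').
by rewrite cardsU (eqP (_ : _ :&: _ == set0)) ?setI_eq0 // cards0 subn0.
Qed.

Lemma min_coset_rep I w : I \subset S -> w \in <<S>> ->
  exists u d, [/\ u \in <<I>>, d \in <<S>>, w = u * d &
                  forall x, x \in <<I>> -> ~~ eta d x].
Proof.
move=> IS wS; have /subsetP WIS := genS IS.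
have I1 : 1 \in <<I>> by apply: group1.
have [u uI umin] := arg_minnP (fun u => len (u^-1 * w)) I1.
have dS : u^-1 * w \in <<S>> by rewrite groupM // groupV WIS.
exists u, (u^-1 * w); split=> // [|x xI]; first by rewrite mulKVg.
apply/negP=> /(exchange_len hS dS)[_]; rewrite ltnNge => /negP[].
have uxI : u * x^-1 \in <<I>> by rewrite groupM // groupV.
by have := umin _ uxI; rewrite invMg invgK -mulgA.
Qed.

(** Since [d] is minimal on both sides, lengths add in both members of [s * d = d * s ^ d]; hence
    [s ^ d] has length 1. *)
Lemma conj_gen_in I J d : I \subset S -> J \subset S -> d \in <<S>> ->
  (forall x, x \in <<I>> -> ~~ eta d x) -> (forall x, x \in <<J>> -> ~~ eta d^-1 x) ->
  I :^ d \subset <<J>> -> I :^ d \subset J.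
Proof.
move=> IS JS dS hI hJ /subsetP sub; apply/subsetP=> _ /imsetP[s sI ->].
have sS := subsetP IS _ sI; have dVS : d^-1 \in <<S>> by rewrite groupV.
have sdJ : s ^ d \in <<J>> by apply/sub; rewrite memJ_conjg.
have sdS : s ^ d \in <<S>> by apply: subsetP (genS JS) _ _.
apply: (len1_gen (reflection_cocycleS JS hS)) => //.
have := len_genM hS sS dS; rewrite (negPf (hI _ (mem_gen sI))) conjgC.
have -> : len (d * s ^ d) = (len (s ^ d) + len d)%N.
  rewrite -(lenV hS (groupM dS sdS)) invMg (len_addM JS) ?groupV //.
  by rewrite !(lenV hS).
lia.
Qed.

(** Take [d] of least length in the double coset of [g] for [<<I>>] and [<<J>>] and apply
    [conj_gen_in]. The left factor is absorbed by [<<I>>], and the right one gives [b]. *)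
Lemma parabolic_sub I J g : I \subset S -> J \subset S -> g \in <<S>> ->
  <<I>> :^ g \subset <<J>> ->
  exists d b, [/\ b \in <<J>>, d \in <<S>>, I :^ d \subset J &
                  <<I>> :^ g = <<I :^ d>> :^ b].
Proof.
move=> IS JS gS sub; have /subsetP WIS := genS IS; have /subsetP WJS := genS JS.
pose Q := [pred p : gT * gT | (p.1 \in <<I>>) && (p.2 \in <<J>>)].
have Q1 : Q (1, 1) by rewrite /= !group1.
have [[a b] /andP[/= aI bJ] dmin] := arg_minnP (fun p => len (p.1 * g * p.2)) Q1.
have [d dE] : {d | d = a * g * b} by exists (a * g * b).
have dS : d \in <<S>> by rewrite dE; rewrite !groupM //; [apply: WIS | apply: WJS].
have dVS : d^-1 \in <<S>> by rewrite groupV.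
have IdJ : <<I>> :^ d = (<<I>> :^ g) :^ b.
  by rewrite dE !conjsgM (conjGid aI).
have hI x : x \in <<I>> -> ~~ eta d x.
  move=> xI; apply/negP=> /(exchange_len hS dS)[_]; rewrite ltnNge => /negP[].
  have Qx : Q (x * a, b) by rewrite /= groupM.
  by have := dmin _ Qx; rewrite dE -!mulgA.
have hJ x : x \in <<J>> -> ~~ eta d^-1 x.
  move=> xJ; apply/negP=> /(exchange_len hS dVS)[xdS]; rewrite ltnNge => /negP[].
  rewrite -(lenV hS xdS) invMg invgK (lenV hS dS).
  have Qx : Q (a, b * x^-1) by rewrite /= aI groupM ?groupV.
  by have := dmin _ Qx; rewrite dE !mulgA.
exists d, b^-1; split; rewrite ?groupV //.
  apply: conj_gen_in => //; apply: subset_trans (_ : <<I>> :^ d \subset _).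
    by rewrite conjSg subset_gen.
  by rewrite IdJ -(conjGid bJ) conjSg.
by rewrite genJ IdJ conjsgK.
Qed.

(** Induction on the length of [w]. Split [w = u * d] along [J = s |: I], with [s] a descent of [w].
    Either [u] already inverts [t], and then [<<J>>] contains [t], or the problem conjugated by [u]
    is solved with the shorter element [d]. *)
Lemma parabolic_join_descent w I t : w \in <<S>> -> I \subset S -> I :^ w \subset S ->
  eta w t -> exists L h, [/\ L \subset S, h \in <<S>>, (#|L| <= #|I|.+1)%N,
    I \subset <<L>> :^ h & t \in <<L>> :^ h].
Proof.
have [n] := ubnP (len w); elim: n w I t => // n IHn w I t ltn wS IS IwS wt.
have [|s sS ws] := exists_descent hS wS.
  by apply: contraTneq wt => ->; rewrite (cocycle1 hS).
pose J := s |: I; have JS : J \subset S by rewrite subUset sub1set sS.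
have [u [d [uJ dS wE hd]]] := min_coset_rep JS wS.
have uS : u \in <<S>> by apply: subsetP (genS JS) _ _.
have wlen : len w = (len u + len d)%N by rewrite wE; apply: (len_addM JS).
have [ut|ut] := boolP (eta u t).
  exists J, 1; rewrite !conjsg1; split; [exact: JS | exact: group1 | | |].
  - by rewrite cardsU1 -add1n leq_add2r leq_b1.
  - by apply: subset_trans (subset_gen J); apply: subsetUr.
  - exact: (inversion_in (reflection_cocycleS JS hS) uJ ut).
have du : eta d (t ^ u) by move: wt; rewrite wE (cocycleM hS) // (negPf ut).
have u1 : u != 1.
  apply: contraTneq ws => u1; rewrite wE u1 mul1g; apply: hd.
  by rewrite mem_gen // setU11.
have lenu : (0 < len u)%N.
  by rewrite lt0n; apply: contra u1 => /eqP /(len0 hS uS) ->.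
(* For [r] in [I], lengths add on the left of [r ^ u * d = d * r ^ w], and [r ^ w] is a generator,
   so [r ^ u] has length at most 1. *)
have IuJ : I :^ u \subset J.
  apply/subsetP=> _ /imsetP[r rI ->].
  have rwS : r ^ w \in S by apply: (subsetP IwS); rewrite memJ_conjg.
  have ruJ : r ^ u \in <<J>> by rewrite groupJ // mem_gen // setU1r.
  apply: (len1_gen (reflection_cocycleS JS hS)) => //.
  have E : r ^ u * d = d * r ^ w by rewrite wE conjgM -conjgC.
  have := congr1 len E; rewrite (len_addM JS ruJ dS hd) => lenE.
  have := lenM hS dS (mem_gen rwS); rewrite -{}lenE (len_gen hS rwS).
  rewrite addnC leq_add2l; suff : len (r ^ u) != 0%N by case: (len _) => [|[]].
  apply: contraTneq (rwS) => /(len0 hS (subsetP (genS JS) _ ruJ)) ru1.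
  by rewrite wE conjgM ru1 conj1g; apply/negP=> /(gen_neq1 hS); rewrite eqxx.
have [|||L [h [LS hL cL IL tL]]] := IHn d (I :^ u) (t ^ u) _ dS _ _ du.
- by move: ltn; rewrite wlen ltnS; apply: leq_trans; rewrite -add1n leq_add2r.
- exact: subset_trans JS.
- by rewrite -conjsgM -wE.
exists L, (h * u^-1); rewrite cardJg in cL; split=> //.
- by rewrite groupM ?groupV.
- by rewrite conjsgM -sub_conjg.
- by rewrite conjsgM mem_conjgV.
Qed.

Lemma reflJ t u : t \in class_support S <<S>> -> u \in <<S>> ->
  t ^ u \in class_support S <<S>>.
Proof.
by case/imset2P=> s v sS vS -> uS; rewrite -conjgM memJ_class_support // groupM.
Qed.

Lemma inversion_refl w x : w \in <<S>> -> eta w x -> x \in class_support S <<S>>.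
Proof.
move=> wS; elim/gen_ind: wS x => [|s v sS vS IHv] x; first by rewrite (cocycle1 hS).
have sG := mem_gen sS; rewrite (cocycleM hS) // (cocycle_gen hS) //.
case: eqVneq => [-> _|_ /= /IHv xs].
  by apply/imset2P; exists s 1; rewrite ?conjg1.
by rewrite -[x](conjgK s) reflJ // groupV.
Qed.

(** Take [w] of maximal length: a reflection [t] that is not an inversion of [w] would make [t * w]
    longer. *)
Lemma exists_longest : exists2 w, w \in <<S>> &
  S :^ w \subset S /\ forall t, t \in class_support S <<S>> -> eta w t.
Proof.
have S1 : 1 \in <<S>> by apply: group1.
have [w wS wmax] := arg_maxnP len S1; exists w => //.
have wT t : t \in class_support S <<S>> -> eta w t.
  move=> tT; have tS := refl_in tT; apply: contraT => wt.
  have twS := groupM tS wS.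
  have : len (t * w) <= len w by apply: wmax.
  rewrite leqNgt => /negP[].
  have [|_] := exchange_len hS twS (x := t).
    by rewrite (cocycleM hS) // (cocycle_refl hS) // conjgg (negPf wt).
  rewrite mulgA; suff -> : t * t = 1 by rewrite mul1g.
  by case/imset2P: tT => s u sS _ ->; rewrite -conjMg (gen_sqr hS) ?conj1g.
split=> //; apply/subsetP=> _ /imsetP[s sS ->]; have sG := mem_gen sS.
have xS : s ^ w \in <<S>> by rewrite groupJ.
apply: (len1_gen hS) => //.
(* Since [s * w = w * s ^ w] and the conjugated inversions of [s ^ w] lie among those of [w], the
   drop of one in length leaves [s ^ w] a single inversion. *)
have := len_genM hS sS wS; rewrite wT; last first.
  by apply/imset2P; exists s 1; rewrite ?conjg1.
rewrite conjgC /len (inversionsM hS) //.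
set A := inversions (s ^ w) :^ w^-1.
have /setIidPl AE : A \subset inversions w.
  apply/subsetP=> y; rewrite mem_conjgV inE => /(inversion_refl xS).
  by move=> yT; rewrite inE wT // -[y](conjgK w) reflJ // groupV.
have AN : A \subset inversions w by apply/setIidPl.
have -> : A :\: inversions w = set0 by apply/eqP; rewrite setD_eq0.
rewrite setU0 cardsD setIC AE => E.
have := subset_leq_card AN; move: E; rewrite /A cardJg.
by move: #|_| #|_|; clear; lia.
Qed.

Lemma parabolic_join I t : I \subset S -> t \in class_support S <<S>> ->
  exists L h, [/\ L \subset S, h \in <<S>>, (#|L| <= #|I|.+1)%N,
    I \subset <<L>> :^ h & t \in <<L>> :^ h].
Proof.
move=> IS tT; have [w wS [SwS wT]] := exists_longest.
apply: (@parabolic_join_descent w) => //; last exact: wT.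
by apply: subset_trans SwS; rewrite conjSg.
Qed.

End Parabolic.
End Length.

(** * Even sets of generators *)

Section EvenSets.
Import GroupScope.
Context {gT : finGroupType}.
Implicit Types (S I J K L A : {set gT}) (x y s t r : gT).

(** Such an [A] is a union of connected components of the Coxeter graph on [I]. With this form,
    intersections and differences need no paths. *)
Definition edge_closed I A : bool :=
  (A \subset I) && [forall x in A, forall y in I, (2 < #[x * y]) ==> (y \in A)].

Lemma edge_closedP I A :
  reflect (A \subset I /\ forall x y, x \in A -> y \in I -> 2 < #[x * y] -> y \in A)
          (edge_closed I A).
Proof.
apply: (iffP andP) => -[AI h]; split=> //.
  by move=> x y xA yI; apply/implyP; move/forall_inP: h => /(_ _ xA)/forall_inP->.
by apply/forall_inP=> x xA; apply/forall_inP=> y yI; apply/implyP; apply: h.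
Qed.

Lemma order_mulC x y : #[x * y] = #[y * x].
Proof. by rewrite -(orderJ (x * y) x) conjgE -!mulgA mulKg. Qed.

Lemma edge_closedI I J K : I \subset J -> edge_closed J K -> edge_closed I (I :&: K).
Proof.
move=> /subsetP IJ /edge_closedP[_ h]; apply/edge_closedP; split; first exact: subsetIl.
by move=> x y /setIP[_ xK] yI xy; rewrite inE yI (h x) // IJ.
Qed.

Lemma edge_closedD I A : edge_closed I A -> edge_closed I (I :\: A).
Proof.
move=> /edge_closedP[AI h]; apply/edge_closedP; split; first exact: subsetDl.
move=> x y /setDP[xI xA] yI xy; rewrite inE yI andbT; apply: contra xA => yA.
by apply: h yA xI _; rewrite order_mulC.
Qed.

Lemma edge_closedDI I A B : edge_closed I A -> edge_closed I B -> edge_closed I (A :\: B).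
Proof.
move=> /edge_closedP[AI hA] /edge_closedD/edge_closedP[_ hB].
apply/edge_closedP; split; first by rewrite subDset subsetU // AI orbT.
move=> x y /setDP[xA xB] yI xy; rewrite inE (hA x) // andbT.
have /setDP[] // : y \in I :\: B by apply: hB xy => //; rewrite inE xB (subsetP AI).
Qed.

Lemma edge_closed_refl I : edge_closed I I.
Proof. exact/edge_closedP. Qed.

Definition component I x : {set gT} := [set y in I | connect (coxeter_edge I) x y].

Lemma component_closed I x : edge_closed I (component I x).
Proof.
apply/edge_closedP; split; first by apply/subsetP=> y /setIdP[].
move=> y z /setIdP[yI xy] zI yz; rewrite inE zI (connect_trans xy) //.
by apply: connect1; rewrite /coxeter_edge /= yI zI.
Qed.

Lemma component_refl I x : x \in I -> x \in component I x.
Proof. by move=> xI; rewrite inE xI connect0. Qed.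

Lemma component_min I A x : edge_closed I A -> x \in A -> component I x \subset A.
Proof.
move=> /edge_closedP[AI h] xA; apply/subsetP=> y /setIdP[_ /connectP[p + ->]].
elim: p x xA => //= z p IHp x xA /andP[/and3P[xI zI xz] /IHp]; apply.
exact: h xz.
Qed.

Lemma component_eq S x y : x \in S -> y \in component S x -> component S y = component S x.
Proof.
move=> xS yx; apply/eqP; rewrite eqEsubset component_min ?component_closed //=.
apply: component_min (component_closed _ _) _; apply: contraLR (yx) => xy.
have cl := edge_closedD (component_closed S y).
apply/negP=> /(subsetP (component_min cl _)); rewrite inE xS xy => /(_ isT).
by rewrite inE component_refl //; case/setIdP: yx.
Qed.

Lemma mem_componentE S x y : x \in S -> y \in S ->
  (y \in component S x) = (component S y == component S x).
Proof.
move=> xS yS; apply/idP/eqP => [|<-]; first exact: component_eq.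
exact: component_refl.
Qed.

Lemma coxeter_componentsE S : coxeter_components S = [set component S x | x in S].
Proof. by []. Qed.

Definition even_set I : Prop := forall A, edge_closed I A -> ~~ odd #|A|.

Lemma even_setP I :
  reflect (even_set I) [forall K in coxeter_components I, ~~ odd #|K|].
Proof.
apply: (iffP forall_inP) => [h A|h K]; last first.
  by rewrite coxeter_componentsE => /imsetP[x _ ->]; apply/h/component_closed.
have [n] := ubnP #|A|; elim: n A => // n IHn A ltn clA.
have [->|/set0Pn[x xA]] := eqVneq A set0; first by rewrite cards0.
have /edge_closedP[AI _] := clA; have xI := subsetP AI _ xA.
have CA := component_min clA xA.
have C0 : 0 < #|component I x| by apply/card_gt0P; exists x; apply: component_refl.
have E := cardsID (component I x) A; rewrite (setIidPr CA) in E.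
rewrite -E oddD (negPf (h _ _)) /=; last by rewrite coxeter_componentsE imset_f.
apply: IHn; last exact: edge_closedDI (component_closed _ _).
by move: ltn C0; rewrite -E; move: #|_| #|_|; clear; lia.
Qed.

Lemma even_set_card I : even_set I -> ~~ odd #|I|.
Proof. by apply; apply: edge_closed_refl. Qed.

Lemma even_setI I K S : I \subset S -> even_set I -> edge_closed S K -> ~~ odd #|I :&: K|.
Proof. by move=> IS h clK; apply: h; apply: edge_closedI clK. Qed.

Lemma setU1_remove t L A : t \notin L -> A \subset t |: L -> A :\ t = L :&: A.
Proof.
move=> tL /subsetP AL; apply/setP=> z; rewrite in_setD1 in_setI.
have [->|zt] /= := eqVneq z t; first by rewrite (negPf tL).
have [zA|] := boolP (z \in A); rewrite ?andbF // andbT.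
by have := AL _ zA; rewrite in_setU1 (negPf zt) /= => ->.
Qed.

(** Without [x], the set [A] is closed in [I] and so has even size. *)
Lemma odd_card_add1 I x A : even_set I -> x \notin I ->
  edge_closed (x |: I) A -> odd #|A| = (x \in A).
Proof.
move=> eI xI clA; have := edge_closedI (subsetUr [set x] I) clA.
move=> /eI; have /edge_closedP[AI _] := clA.
rewrite (cardsD1 x A) oddD (setU1_remove xI AI).
by move=> /negPf ->; rewrite addbF oddb.
Qed.

(** The new generator [t] is attached to the only odd component, that of [x]. A closed set then
    contains both [x] and [t] or neither, and their parities cancel. *)
Lemma even_set_add2 I x t : even_set I -> x \notin I -> t \notin x |: I ->
  (exists2 y, y \in component (x |: I) x & 2 < #[y * t]) -> even_set (t |: (x |: I)).
Proof.
move=> eI xI tI [y yC yt] A clA.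
have yxI : y \in x |: I by case/setIdP: yC.
have xxI : x \in x |: I by apply: setU11.
have /edge_closedP[AI hA] := clA.
have clA' := edge_closedI (subsetUr [set t] (x |: I)) clA.
have xy : (x \in A) = (y \in A).
  apply/idP/idP => [xA|]; last apply: contraLR => xA.
    have /component_min/(_ _)/subsetP/(_ _ yC) := clA'.
    by rewrite !in_setI xxI xA yxI; apply.
  have /component_min/(_ _)/subsetP/(_ _ yC) := edge_closedD clA'.
  by rewrite !in_setD !in_setI xxI (negPf xA) yxI /= andbT; apply.
have ty : (t \in A) = (y \in A).
  apply/idP/idP => [tA|yA].
    by apply: (hA t); rewrite ?(order_mulC t) // setU1r.
  by apply: (hA y); rewrite ?setU11.
have := odd_card_add1 eI xI clA'; rewrite in_setI xxI /= xy -ty.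
by rewrite (cardsD1 t A) oddD oddb (setU1_remove tI AI) => ->; rewrite addbb.
Qed.

(** Parity again. Consequently the two added generators lie in one component of [S], which becomes
    the color of the cover. *)
Lemma even_set_same_color I x t A : even_set I -> x \notin I -> t \notin x |: I ->
  even_set (t |: (x |: I)) -> edge_closed (t |: (x |: I)) A -> (x \in A) = (t \in A).
Proof.
move=> eI xI tI eL clA; have /eL := clA.
have := odd_card_add1 eI xI (edge_closedI (subsetUr [set t] (x |: I)) clA).
have /edge_closedP[AI _] := clA.
rewrite (cardsD1 t A) oddD oddb (setU1_remove tI AI) => ->.
by rewrite in_setI setU11 /=; do 2!case: (_ \in A).
Qed.

Lemma even_set_extend S I x : I \subset S -> even_set I -> x \in S -> x \notin I ->
  ~~ edge_closed S (component (x |: I) x) ->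
  exists t, [/\ t \in S, t \notin x |: I & even_set (t |: (x |: I))].
Proof.
move=> IS eI xS xI ncl.
have xIS : x |: I \subset S by rewrite subUset sub1set xS.
have [y [t [yC tS tC yt]]] : exists y t,
    [/\ y \in component (x |: I) x, t \in S, t \notin component (x |: I) x & 2 < #[y * t]].
  move: ncl; rewrite /edge_closed (subset_trans _ xIS) /=; last first.
    by apply/subsetP=> y /setIdP[].
  rewrite negb_forall_in => /exists_inP[y yC]; rewrite negb_forall_in.
  by move=> /exists_inP[t tS]; rewrite negb_imply => /andP[yt tC]; exists y, t.
have tI : t \notin x |: I.
  apply: contra tC => tI; have /edge_closedP[_ h] := component_closed (x |: I) x.
  exact: h yt.
by exists t; split=> //; apply: even_set_add2 => //; exists y.
Qed.

Lemma even_set_between I J : I \subset J -> even_set I -> even_set J -> I != J ->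
  exists x t, [/\ x \in J, t \in J, x \notin I, t \notin x |: I &
    even_set (t |: (x |: I))].
Proof.
move=> IJ eI eJ IneJ; have /properP[_ [x xJ xI]] : I \proper J by rewrite properEneq IneJ.
have [|t [tJ tI eL]] := even_set_extend IJ eI xJ xI; last by exists x, t.
(* The component of [x] is odd, so it is not closed in the even set [J], and some edge of [J] leaves
   it. *)
apply/negP=> /eJ; rewrite (odd_card_add1 eI xI (component_closed _ _)).
by rewrite component_refl // setU11.
Qed.

Lemma even_setJ I d : even_set I -> even_set (I :^ d).
Proof.
move=> eI A clA; rewrite -(cardJg A d^-1); apply: eI.
have /edge_closedP[AI h] := clA; apply/edge_closedP; split.
  by rewrite -(conjsgK d I) conjSg.
move=> x y; rewrite !mem_conjgV => xA yI xy.
by apply: (h (x ^ d)); rewrite ?memJ_conjg // -conjMg orderJ.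
Qed.

End EvenSets.

(** * Inclusions and joins of parabolic subgroups *)

Section Parabolics.
Import GroupScope.
Context {gT : finGroupType} (eta : gT -> gT -> bool) (S : {set gT}).
Hypothesis hS : reflection_cocycle S eta.
Implicit Types (I J K L C : {set gT}) (g h s t x y : gT).

Lemma mem_gen_sub J s : J \subset S -> s \in S -> s \in <<J>> -> s \in J.
Proof.
move=> JS sS sJ; apply: (len1_gen (reflection_cocycleS JS hS)) => //.
exact: (len_gen hS).
Qed.

Lemma edge_closed_commute L C x y : L \subset S -> edge_closed L C ->
  x \in C -> y \in L -> y \notin C -> commute x y.
Proof.
move=> LS /edge_closedP[CL h] xC yL yC.
have sq : (x * y) ^+ 2 = 1.
  have : #[x * y] <= 2 by rewrite leqNgt; apply: contra yC; apply: h.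
  have := order_gt0 (x * y); case E: #[x * y] => [|[|[|]]] // _ _.
    by move/eqP: E; rewrite order_eq1 => /eqP ->; rewrite expg1n.
  by rewrite -E expg_order.
have xx : x * x = 1 by apply: (gen_sqr hS); apply: (subsetP LS); apply: (subsetP CL).
have yy : y * y = 1 by apply: (gen_sqr hS); apply: (subsetP LS).
apply: (mulgI (x * y)); rewrite -[LHS]/((x * y) ^+ 2) sq.
by rewrite -!mulgA (mulgA y) yy mul1g xx.
Qed.

Lemma edge_closed_cent L C : L \subset S -> edge_closed L C ->
  <<C>> \subset 'C(<<L :\: C>>).
Proof.
move=> LS clC; rewrite gen_subG centsC gen_subG; apply/subsetP=> y /setDP[yL yC].
apply/centP=> x xC; exact/commute_sym/(edge_closed_commute LS clC).
Qed.

Lemma edge_closed_norm L C : L \subset S -> edge_closed L C ->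
  <<L>> \subset 'N(<<C>>).
Proof.
move=> LS clC; have CL : C \subset L by case/edge_closedP: clC.
rewrite gen_subG; apply/subsetP=> y yL.
have [yC|yC] := boolP (y \in C).
  by apply: subsetP (normG <<C>>) _ _; apply: mem_gen.
apply: (subsetP (cent_sub _)); apply: (subsetP (_ : <<L :\: C>> \subset _)).
  by rewrite centsC edge_closed_cent.
by apply: mem_gen; rewrite inE yC.
Qed.

Lemma edge_closed_conj L C b : L \subset S -> edge_closed L C -> b \in <<L>> ->
  <<C>> :^ b = <<C>>.
Proof. by move=> LS clC bL; apply/normP/(subsetP (edge_closed_norm LS clC)). Qed.

(** Turns an inclusion of parabolic subgroups into an inclusion of generators in the common frame
    [b * h]. As [b] lies in [<<J>>], the larger group is still [<<J>>] in that frame. *)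
Lemma parabolic_align I J g h : I \subset S -> J \subset S ->
  g \in <<S>> -> h \in <<S>> -> <<I>> :^ g \subset <<J>> :^ h ->
  exists d b, [/\ d \in <<S>>, b \in <<J>>, I :^ d \subset J &
                  <<I>> :^ g = <<I :^ d>> :^ (b * h)].
Proof.
move=> IS JS gS hW' sub0.
have sub : <<I>> :^ (g * h^-1) \subset <<J>> by rewrite conjsgM sub_conjgV.
have [|d [b [bJ dS IdJ E]]] := parabolic_sub hS IS JS _ sub.
  by rewrite groupM ?groupV.
by exists d, b; split=> //; rewrite conjsgM -E -conjsgM mulgKV.
Qed.

Lemma edge_closed_mem K s d : edge_closed S K -> s \in S -> d \in <<S>> ->
  s ^ d \in <<K>> -> s \in K.
Proof.
move=> clK sS dS; have KS : K \subset S by case/edge_closedP: clK.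
rewrite -mem_conjgV (edge_closed_conj (subxx S) clK) ?groupV //.
exact: mem_gen_sub.
Qed.

Lemma conj_gen_color I J K d : I \subset S -> J \subset S -> edge_closed S K ->
  d \in <<S>> -> I :^ d \subset J -> (I :&: K) :^ d \subset J :&: K.
Proof.
move=> IS JS clK dS IdJ; have KS : K \subset S by case/edge_closedP: clK.
rewrite conjIg subsetI (subset_trans (subsetIl _ _)) //=.
apply/subsetP=> x /setIP[/(subsetP IdJ) /(subsetP JS) xS xK].
apply: (mem_gen_sub KS xS); rewrite -(edge_closed_conj (subxx S) clK dS).
by apply: subsetP xK; rewrite conjSg subset_gen.
Qed.

Lemma parabolic_color_le I J K g h : I \subset S -> J \subset S -> edge_closed S K ->
  g \in <<S>> -> h \in <<S>> -> <<I>> :^ g \subset <<J>> :^ h ->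
  #|I :&: K| <= #|J :&: K|.
Proof.
move=> IS JS clK gS hW' /(parabolic_align IS JS gS hW')[d [b [dS _ IdJ _]]].
by rewrite -(cardJg _ d) subset_leq_card // conj_gen_color.
Qed.

(** Equal ranks in [K] force [I :&: K] to be conjugate by [d] onto all of [J :&: K], and [b]
    normalizes the subgroup that the latter generates. Uniqueness of joins rests on this. *)
Lemma parabolic_color_part I J K g h : I \subset S -> J \subset S -> edge_closed S K ->
  g \in <<S>> -> h \in <<S>> -> <<I>> :^ g \subset <<J>> :^ h ->
  #|I :&: K| = #|J :&: K| -> <<J :&: K>> :^ h \subset <<I>> :^ g.
Proof.
move=> IS JS clK gS hW' /(parabolic_align IS JS gS hW')[d [b [dS bJ IdJ ->]]] E.
rewrite conjsgM conjSg.
have EK : (I :&: K) :^ d = J :&: K.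
  by apply/eqP; rewrite eqEcard conj_gen_color //= cardJg E.
rewrite -(edge_closed_conj JS (edge_closedI JS clK) bJ) conjSg -EK.
by rewrite genS // conjSg subsetIl.
Qed.

Lemma parabolic_eq I J g h : I \subset S -> J \subset S ->
  g \in <<S>> -> h \in <<S>> -> <<I>> :^ g \subset <<J>> :^ h ->
  #|J| <= #|I| -> <<I>> :^ g = <<J>> :^ h.
Proof.
move=> IS JS gS hW' /(parabolic_align IS JS gS hW')[d [b [dS bJ IdJ ->]]] le.
have -> : I :^ d = J by apply/eqP; rewrite eqEcard IdJ cardJg.
by rewrite conjsgM (conjGid bJ).
Qed.

(** By [parabolic_sub], a reflection in [<<L>>] is conjugate inside [<<L>>] to a generator in [L],
    and both factors are normal in [<<L>>]. *)
Lemma reflection_split L C s g : L \subset S -> edge_closed L C -> s \in S ->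
  g \in <<S>> -> s ^ g \in <<L>> -> (s ^ g \in <<C>>) || (s ^ g \in <<L :\: C>>).
Proof.
move=> LS clC sS gS sgL.
have sub : <<[set s]>> :^ g \subset <<L>>.
  by rewrite -genJ conjg_set1 gen_subG sub1set.
have s1S : [set s] \subset S by rewrite sub1set.
have [d [b [bL dS sdL E]]] := parabolic_sub hS s1S LS gS sub.
have sgE : s ^ g \in <<[set s ^ d]>> :^ b.
  by rewrite -conjg_set1 -E memJ_conjg mem_gen ?set11.
have sdL' : s ^ d \in L by rewrite -sub1set -conjg_set1.
have [sC|sC] := boolP (s ^ d \in C).
  rewrite (subsetP _ _ sgE) // -(edge_closed_conj LS clC bL) conjSg.
  by rewrite genS // sub1set.
rewrite orbC (subsetP _ _ sgE) // -(edge_closed_conj LS (edge_closedD clC) bL) conjSg.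
by rewrite genS // sub1set inE sC.
Qed.

Lemma parabolic_color_eq I J K g h : I \subset S -> J \subset S -> edge_closed S K ->
  g \in <<S>> -> h \in <<S>> -> <<I>> :^ g = <<J>> :^ h -> #|I :&: K| = #|J :&: K|.
Proof.
move=> IS JS clK gS hW' E; apply/eqP; rewrite eqn_leq.
rewrite (parabolic_color_le IS JS clK gS hW') ?E //=.
by rewrite (parabolic_color_le JS IS clK hW' gS) ?E.
Qed.

Lemma parabolic_conj_join I g s q : I \subset S -> g \in <<S>> -> s \in S -> q \in <<S>> ->
  exists L p, [/\ L \subset S, p \in <<S>>, #|L| <= #|I|.+1,
    <<I>> :^ g \subset <<L>> :^ p & s ^ q \in <<L>> :^ p].
Proof.
move=> IS gS sS qS.
have tT : s ^ (q * g^-1) \in class_support S <<S>>.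
  by rewrite memJ_class_support // groupM ?groupV.
have [L [h [LS hW' cL IL sL]]] := parabolic_join hS IS tT.
exists L, (h * g); split=> //; first exact: groupM.
  by rewrite conjsgM conjSg gen_subG.
by rewrite conjsgM mem_conjg -conjgM.
Qed.

Lemma subset_setU1 (I L : {set gT}) : I \subset L -> I != L -> #|L| <= #|I|.+1 ->
  exists2 x, x \notin I & L = x |: I.
Proof.
move=> IL IneL cL; have /properP[_ [x xL xI]] : I \proper L by rewrite properEneq IneL.
exists x => //; apply/esym/eqP; rewrite eqEcard subUset sub1set xL IL /=.
by rewrite cardsU1 xI.
Qed.

Lemma card_setU1I (I K : {set gT}) x : x \notin I -> #|(x |: I) :&: K| = (x \in K) + #|I :&: K|.
Proof.
move=> xI; rewrite setIUl cardsU (_ : _ :&: _ :&: _ = set0) ?cards0 ?subn0.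
  congr (_ + _); case: (boolP (x \in K)) => xK.
    by rewrite (setIidPl _) ?cards1 ?sub1set.
  by rewrite (_ : _ :&: _ = set0) ?cards0 //; apply/setP=> y; rewrite !inE;
     case: eqVneq => // ->; rewrite (negPf xK).
by apply/setP=> y; rewrite !inE; case: eqVneq => // ->; rewrite (negPf xI) !andbF.
Qed.

Lemma card_even_add2 I K x t : I \subset S -> x \in S -> t \in S ->
  even_set I -> x \notin I -> t \notin x |: I ->
  even_set (t |: (x |: I)) -> edge_closed S K ->
  #|(t |: (x |: I)) :&: K| = (x \in K).*2 + #|I :&: K|.
Proof.
move=> IS xS tS eI xI tI eL clK.
have LS : t |: (x |: I) \subset S by rewrite !subUset !sub1set xS tS.
have := even_set_same_color eI xI tI eL (edge_closedI LS clK).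
rewrite !in_setI !setU11 setU1r ?setU11 //= => xt.
by rewrite !card_setU1I // -xt addnA addnn.
Qed.

(* In the second alternative the two covers differ only inside the odd component
   [K] of [S], and both fill it up to one generator. *)
Lemma even_cover_join J0 J1 J2 g0 g1 g2 :
  J0 \subset S -> J1 \subset S -> J2 \subset S ->
  even_set J0 -> even_set J1 -> even_set J2 ->
  g0 \in <<S>> -> g1 \in <<S>> -> g2 \in <<S>> ->
  <<J0>> :^ g0 \subset <<J1>> :^ g1 -> <<J0>> :^ g0 \subset <<J2>> :^ g2 ->
  #|J1| = #|J0|.+2 -> #|J2| = #|J0|.+2 -> <<J1>> :^ g1 != <<J2>> :^ g2 ->
  (exists L h, [/\ L \subset S, even_set L, h \in <<S>>,
      <<J1>> :^ g1 \subset <<L>> :^ h /\ <<J2>> :^ g2 \subset <<L>> :^ h &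
      forall K, edge_closed S K ->
        #|L :&: K| + #|J0 :&: K| = #|J1 :&: K| + #|J2 :&: K|]) \/
  (exists K, [/\ K \in coxeter_components S, odd #|K|, #|J1 :&: K|.+1 = #|K|,
      #|J2 :&: K|.+1 = #|K| & #|J0 :&: K|.+2 = #|J2 :&: K|]).
Proof.
move=> J0S J1S J2S eJ0 eJ1 eJ2 g0S g1S g2S sub1 sub2 c1 c2 neq.
(* Present the lower group and the second cover in one frame [q], with types [I] and
   [J2 = t' |: (s' |: I)], where [s' ^ q] is outside the first cover. *)
have [d0 [b0 [d0S b0J IJ2 ZE]]] := parabolic_align J0S J2S g0S g2S sub2.
have [I IE] : {I | I = J0 :^ d0} by exists (J0 :^ d0).
have [q qE] : {q | q = b0 * g2} by exists (b0 * g2).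
have QE : <<J2>> :^ g2 = <<J2>> :^ q by rewrite qE conjsgM (conjGid b0J).
have qS : q \in <<S>> by rewrite qE groupM // (subsetP (genS J2S)).
have eI : even_set I by rewrite IE; apply: even_setJ.
have cI : #|I| = #|J0| by rewrite IE cardJg.
rewrite -IE in IJ2; rewrite -IE -qE in ZE; have IS := subset_trans IJ2 J2S.
have cIK K : edge_closed S K -> #|I :&: K| = #|J0 :&: K|.
  by move=> clK; apply/esym/(parabolic_color_eq J0S IS clK g0S qS).
rewrite {}ZE in sub1 sub2; rewrite {}QE in sub2 neq *.
have [s' s'J2 sP] : exists2 s', s' \in J2 & s' ^ q \notin <<J1>> :^ g1.
  apply/exists_inP; apply: contraNT neq; rewrite negb_exists_in => /forall_inP h.
  rewrite eq_sym; apply/eqP/parabolic_eq; rewrite ?c1 ?c2 //.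
  rewrite -genJ gen_subG; apply/subsetP=> _ /imsetP[y yJ2 ->].
  by have := h _ yJ2; rewrite negbK.
have s'I : s' \notin I.
  by apply: contra sP => s'I; apply: (subsetP sub1); rewrite memJ_conjg mem_gen.
have [t' t'I J2E] : exists2 t', t' \notin s' |: I & J2 = t' |: (s' |: I).
  have cs : #|s' |: I| = #|I|.+1 by rewrite cardsU1 s'I.
  apply: subset_setU1; rewrite ?subUset ?sub1set ?s'J2 //; last by rewrite cs cI c2.
  by apply: contraTneq (leqnn #|J2|) => {2}<-; rewrite cs cI c2 ltnn.
have t'J2 : t' \in J2 by rewrite J2E setU11.
have s'S := subsetP J2S _ s'J2; have t'S := subsetP J2S _ t'J2.
have cJ2 K : edge_closed S K -> #|J2 :&: K| = (s' \in K).*2 + #|I :&: K|.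
  by move=> clK; rewrite J2E card_even_add2 // -J2E.
(* Adjoin [s' ^ q] to the first cover, and then [t' ^ q] if it is still missing. The frame [p] is
   chosen so that both enlargements are generated by subsets of [S]. *)
have [L1 [p [[L1S pS cL1] PM1 sM1 alt]]] : exists L1 p,
    [/\ [/\ L1 \subset S, p \in <<S>> & #|L1| <= #|J1|.+1],
        <<J1>> :^ g1 \subset <<L1>> :^ p, s' ^ q \in <<L1>> :^ p &
        t' ^ q \notin <<L1>> :^ p -> exists r,
          [/\ r \in S, r \notin L1 & t' ^ q \in <<r |: L1>> :^ p]].
  have [L [p0 [LS p0S cL PL sL]]] := parabolic_conj_join J1S g1S s'S qS.
  have [tL|tL] := boolP (t' ^ q \in <<L>> :^ p0).
    by exists L, p0; split=> //; rewrite tL.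
  have [L2 [p2 [L2S p2S cL2 LL2 tL2]]] := parabolic_conj_join LS p0S t'S qS.
  have [d [b [dS bL2 LdL2 E]]] := parabolic_align LS L2S p0S p2S LL2.
  have bS : b \in <<S>> by rewrite (subsetP (genS L2S)).
  have E2 : <<L2>> :^ p2 = <<L2>> :^ (b * p2) by rewrite conjsgM (conjGid bL2).
  exists (L :^ d), (b * p2); rewrite -E; split=> //.
    by split; rewrite ?cardJg //; [apply: subset_trans L2S | apply: groupM].
  move=> _; have [||r rL L2E] := subset_setU1 LdL2.
  - by apply: contraNneq tL => LE; rewrite E LE -E2.
  - by rewrite cardJg.
  by exists r; rewrite -L2E -E2; split=> //; apply: (subsetP L2S); rewrite L2E setU11.
have [d1 [b1 [d1S b1L IL1 PE]]] := parabolic_align J1S L1S g1S pS PM1.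
have {p pS PM1 sM1 alt PE} [p [pS PE sM1 alt]] : exists p,
   [/\ p \in <<S>>, <<J1>> :^ g1 = <<J1 :^ d1>> :^ p,
       s' ^ q \in <<L1>> :^ p &
       t' ^ q \notin <<L1>> :^ p -> exists r,
          [/\ r \in S, r \notin L1 & t' ^ q \in <<r |: L1>> :^ p]].
  have EL : <<L1>> :^ p = <<L1>> :^ (b1 * p) by rewrite conjsgM (conjGid b1L).
  exists (b1 * p); rewrite -EL; split=> //.
    by rewrite groupM // (subsetP (genS L1S)).
  move=> /alt[r [rS rL tL]]; exists r; split=> //.
  have b1rL : b1 \in <<r |: L1>> by apply: subsetP (genS (subsetUr _ _)) _ b1L.
  by rewrite conjsgM (conjGid b1rL).
have eI1 : even_set (J1 :^ d1) by apply: even_setJ.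
have cI1 : #|J1 :^ d1| = #|J1| by rewrite cardJg.
move: (J1 :^ d1) IL1 PE eI1 cI1 => I1 IL1 PE eI1 cI1.
have I1S := subset_trans IL1 L1S.
have cI1K K : edge_closed S K -> #|I1 :&: K| = #|J1 :&: K|.
  by move=> clK; apply/esym/(parabolic_color_eq J1S I1S clK g1S pS).
have [||x xI1 L1E] := subset_setU1 IL1.
- by apply: contraNneq sP => E; rewrite PE E.
- by rewrite cI1.
have xL1 : x \in L1 by rewrite L1E setU11.
have xS := subsetP L1S _ xL1.
(* [L1] is the even set [I1] with [x] added, so [C] is its only odd component. *)
have [C CE0] : {C | C = component L1 x} by exists (component L1 x).
have xC : x \in C by rewrite CE0 component_refl.
have clC : edge_closed L1 C by rewrite CE0; apply: component_closed.
have CL1 : C \subset L1 by case/edge_closedP: clC.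
have qpS : q * p^-1 \in <<S>> by rewrite groupM ?groupV.
(* Otherwise this reflection lies in the other factor, generated inside [I1], and [s' ^ q] would
   belong to the first cover. *)
have sC : s' ^ (q * p^-1) \in <<C>>.
  have := reflection_split L1S clC s'S qpS.
  rewrite conjgM -mem_conjg sM1 => /(_ isT)/orP[//|sLC].
  case/negP: sP; rewrite PE mem_conjg; apply: subsetP sLC; rewrite genS //.
  apply/subsetP=> y /setDP[]; rewrite L1E => /setU1P[->|//].
  by rewrite xC.
have CK K : edge_closed S K -> x \in K -> C \subset K.
  move=> clK xK; apply: subset_trans (subsetIr L1 K).
  by rewrite CE0; apply: component_min; rewrite ?inE ?xL1 //; apply: edge_closedI clK.
have xK_sK K : edge_closed S K -> x \in K -> s' \in K.
  move=> clK xK; apply: (edge_closed_mem clK s'S qpS).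
  by apply: subsetP sC; apply/genS/CK.
have xsK K : edge_closed S K -> (x \in K) = (s' \in K).
  move=> clK; apply/idP/idP=> [|sK]; first exact: xK_sK.
  apply: contraLR (sK) => xK; have : s' \in S :\: K; last by case/setDP.
  by apply: (xK_sK _ (edge_closedD clK)); rewrite inE xK.
have J2sub (L : {set gT}) : L1 \subset L -> t' ^ q \in <<L>> :^ p ->
    <<J2>> :^ q \subset <<L>> :^ p.
  move=> L1L tL; have sub : <<L1>> :^ p \subset <<L>> :^ p by rewrite conjSg genS.
  rewrite -genJ gen_subG; apply/subsetP=> _ /imsetP[y + ->]; rewrite J2E.
  case/setU1P=> [->//|/setU1P[->|yI]]; first exact: (subsetP sub).
  apply: (subsetP sub); apply: (subsetP (_ : <<J1>> :^ g1 \subset _)).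
    by rewrite PE conjSg genS.
  by apply: (subsetP sub1); rewrite memJ_conjg mem_gen.
(* Any even [r |: L1] containing [t' ^ q] gives the join. It adds [x] and [r] to [I1] just as [J2]
   adds [s'] and [t'] to [I], and [x] and [s'] lie in the same component of [S]. *)
have fin r : r \in S -> r \notin L1 -> even_set (r |: L1) ->
    t' ^ q \in <<r |: L1>> :^ p ->
  exists L h, [/\ L \subset S, even_set L, h \in <<S>>,
      <<J1>> :^ g1 \subset <<L>> :^ h /\ <<J2>> :^ q \subset <<L>> :^ h &
      forall K, edge_closed S K ->
        #|L :&: K| + #|J0 :&: K| = #|J1 :&: K| + #|J2 :&: K|].
  move=> rS rL1 eL tL; have sL : L1 \subset r |: L1 by apply: subsetUr.
  exists (r |: L1), p; split=> //.
  - by rewrite subUset sub1set rS.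
  - split; last exact: J2sub.
    by rewrite PE conjSg genS // (subset_trans IL1).
  move=> K clK; rewrite L1E in rL1 eL *; rewrite card_even_add2 // cJ2 // cI1K // cIK //.
  by rewrite xsK // addnAC addnC addnA.
have [tM1|tM1] := boolP (t' ^ q \in <<L1>> :^ p).
  (* If [C] is not a whole component of [S], a generator adjacent to it completes the join;
     otherwise [C] is the exceptional component. *)
  have [clCS|nclCS] := boolP (edge_closed S C); last first.
    left; rewrite CE0 L1E in nclCS.
    have [r [rS rL1 eL]] := even_set_extend I1S eI1 xS xI1 nclCS.
    rewrite -L1E in rL1 eL; apply: (fin r) => //.
    by apply: subsetP tM1; rewrite conjSg genS // subsetUr.
  right; exists C.
  have oC : odd #|C|.
    by rewrite L1E in clC; rewrite (odd_card_add1 eI1 xI1 clC) xC.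
  have CE : C = L1 :&: C by apply/esym/setIidPr.
  have cC : #|C| = #|I1 :&: C|.+1.
    by rewrite {1}CE {1}L1E card_setU1I // xC.
  have cJ2C : #|J2 :&: C| = #|I :&: C|.+2 by rewrite cJ2 // -xsK // xC.
  split=> //.
  - suff -> : C = component S x by rewrite coxeter_componentsE imset_f.
    apply/eqP; rewrite eqEsubset CK ?component_closed ?component_refl //=.
    exact: component_min.
  - by rewrite cC cI1K.
  (* [J2] has one generator fewer than [L1] and at most as many outside [C], so it misses at most
     one inside [C]. It misses exactly one because [C] is odd and [J2 :&: C] is even. *)
  - have QM1 := J2sub _ (subxx L1) tM1.
    have le := parabolic_color_le J2S L1S (edge_closedD clCS) qS pS QM1.
    have := cardsID C J2; have := cardsID C L1; rewrite -CE L1E cardsU1 xI1 cI1 c1.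
    have e2 : ~~ odd #|J2 :&: C| by apply: even_setI J2S eJ2 clCS.
    have le2 : #|J2 :&: C| <= #|C| by rewrite subset_leq_card // subsetIr.
    have lt2 : #|J2 :&: C| < #|C|.
      by rewrite ltn_neqAle le2 andbT; apply: contraNneq e2 => ->.
    have : #|J2 :\: C| <= #|(x |: I1) :\: C|.
      have DE (L : {set gT}) : L \subset S -> L :&: (S :\: C) = L :\: C.
        by move=> LS; rewrite setIDA (setIidPl LS).
      by rewrite -L1E -(DE _ J2S) -(DE _ L1S).
    rewrite c2; move: lt2; clear.
    by move: #|_ :&: _| #|_ :\: _| #|_ :\: _| #|C| #|J0|; lia.
  - by rewrite cJ2C cIK.
left; have [r [rS rL1 tL2]] := alt tM1.
apply: (fin r) => //; rewrite L1E in rL1 *; apply: even_set_add2 => //.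
(* If no edge joined [C] to [r], the generators of [J2] conjugated into [<<C>>] would form a closed
   subset containing [s'] but not [t'], against [even_set_same_color]. *)
apply/exists_inP; rewrite -L1E -CE0; apply: contraT; rewrite negb_exists_in => /forall_inP noedge.
rewrite -L1E in rL1; pose L2 := r |: L1.
have L2S : L2 \subset S by rewrite subUset sub1set rS.
have clC2 : edge_closed L2 C.
  apply/edge_closedP; split; first by rewrite (subset_trans CL1) // subsetUr.
  move=> y z yC /setU1P[->|zL1] yz; first by have := noedge _ yC; rewrite yz.
  by case/edge_closedP: clC => _ h; apply: h yz.
have J2L2 y : y \in J2 -> y ^ (q * p^-1) \in <<L2>>.
  move=> yJ2; rewrite conjgM -mem_conjg.
  by apply: (subsetP (J2sub L2 (subsetUr _ _) tL2)); rewrite memJ_conjg mem_gen.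
pose A := [set y in J2 | y ^ (q * p^-1) \in <<C>>].
(* By [reflection_split], each generator in [J2] is conjugated into [<<C>>] or into a factor
   commuting with it, and adjacent generators do not commute. *)
have clA : edge_closed J2 A.
  apply/edge_closedP; split; first by apply/subsetP=> y /setIdP[].
  move=> y z /setIdP[yJ2 yC] zJ2 yz; rewrite inE zJ2 /=.
  have zS := subsetP J2S _ zJ2; have yS := subsetP J2S _ yJ2.
  case/orP: (reflection_split L2S clC2 zS qpS (J2L2 _ zJ2)) => // zD.
  have := centsP (edge_closed_cent L2S clC2) _ yC _ zD.
  rewrite /commute -!conjMg => /conjg_inj yzC.
  suff : #[y * z] <= 2 by rewrite leqNgt yz.
  apply: dvdn_leq => //; rewrite order_dvdn.
  rewrite expgS expg1 {1}yzC mulgA -(mulgA z).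
  by rewrite (gen_sqr hS yS) mulg1 (gen_sqr hS zS).
rewrite J2E in clA eJ2.
have := even_set_same_color eI s'I t'I eJ2 clA.
rewrite !inE s'J2 t'J2 sC; case: (boolP (_ \in <<C>>)) => // tC _.
by case/negP: tM1; rewrite mem_conjg -conjgM; apply: subsetP tC; apply: genS.
Qed.

End Parabolics.

(** * The poset of even parabolic subgroups *)

Section EvenParabolics.
Import Order.TTheory GroupScope.
Context {gT : finGroupType} (W : {group gT}) (S : {set gT}) (eta : gT -> gT -> bool).
Hypothesis hS : reflection_cocycle S eta.
Hypothesis genW : <<S>> = W.
Notation T := (even_parabolic_poset W S).
Implicit Types (I J K L : {set gT}) (x y z a b w : T).

Lemma even_parabolic_leE x y : (x <= y)%O = (x \subset y).
Proof. by []. Qed.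

(** A chosen type of [x]. Another choice may be a different set, but by [even_color_rankE] it meets
    each component of [S] in the same number of generators. *)
Definition even_type x : {set gT} := xchoose (existsP (valP x)).

Lemma even_typeP x : [/\ even_type x \subset S, even_set (even_type x) &
  exists2 g, g \in <<S>> & x = <<even_type x>> :^ g :> {set gT}].
Proof.
rewrite /even_type; have := xchooseP (existsP (valP x)).
move: (xchoose _) => I /andP[/andP[IS /imsetP[g gW xE]] /even_setP eI].
by split=> //; exists g; rewrite ?genW.
Qed.

Lemma exists_even_parabolic I g : I \subset S -> even_set I -> g \in <<S>> ->
  exists x : T, x = <<I>> :^ g :> {set gT}.
Proof.
move=> IS eI gS; have ev : even_parabolic W S (<<I>> :^ g)%G.
  apply/existsP; exists I; rewrite /parabolic_with_type IS /=.
  apply/andP; split; last exact/even_setP.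
  by apply/imsetP; exists g; rewrite // -genW.
by exists (EvenParabolic ev).
Qed.

Lemma even_parabolic_eq x y : x = y :> {set gT} -> x = y.
Proof. by move=> E; apply/val_inj/group_inj. Qed.

(* Colors are the simple systems of the irreducible components of [W]; any other
   set of generators has rank [0]. *)
Definition even_color_rank x K :=
  if K \in coxeter_components S then #|even_type x :&: K|./2 else 0.

Definition even_color_max K := if K \in coxeter_components S then #|K|./2 else 0.

Lemma mem_components K : K \in coxeter_components S ->
  edge_closed S K /\ forall s, s \in S -> (s \in K) = (K == component S s).
Proof.
rewrite coxeter_componentsE => /imsetP[t tS ->]; split; first exact: component_closed.
by move=> s sS; rewrite mem_componentE // eq_sym.
Qed.

Lemma component_in s : s \in S -> component S s \in coxeter_components S.
Proof. by move=> sS; rewrite coxeter_componentsE imset_f. Qed.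

Lemma even_color_rankE x K I g : K \in coxeter_components S -> I \subset S ->
  g \in <<S>> -> x = <<I>> :^ g :> {set gT} -> (even_color_rank x K).*2 = #|I :&: K|.
Proof.
move=> KC IS gS xE; rewrite /even_color_rank KC.
have [clK _] := mem_components KC; have [JS eJ [h hW xE']] := even_typeP x.
rewrite (parabolic_color_eq hS IS JS clK gS hW) -?xE //.
by rewrite even_halfK // (even_setI JS eJ clK).
Qed.

Lemma even_color_rank_type x K : K \in coxeter_components S ->
  (even_color_rank x K).*2 = #|even_type x :&: K|.
Proof.
by move=> KC; have [JS _ [h hW xE]] := even_typeP x; apply: even_color_rankE xE.
Qed.

Lemma colored_coverI c x y : (x <= y)%O ->
  (forall K, even_color_rank y K = even_color_rank x K + (K == c)) ->
  colored_cover even_color_rank c x y.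
Proof.
move=> xy E; apply/colored_coverP; split=> //.
rewrite lt_neqAle xy andbT; apply: contra_eqN (E c) => /eqP ->.
by rewrite eqxx -[X in X == _]addn0 eqn_add2l.
Qed.

Lemma colored_cover_color c x y : colored_cover even_color_rank c x y ->
  c \in coxeter_components S.
Proof.
move=> /colored_coverP[_ /(_ c)]; rewrite /even_color_rank eqxx.
by case: (c \in _).
Qed.

Lemma colored_cover_type c x y K : colored_cover even_color_rank c x y ->
  K \in coxeter_components S ->
  #|even_type y :&: K| = #|even_type x :&: K| + (K == c).*2.
Proof.
move=> /colored_coverP[_ E] KC.
by rewrite -!even_color_rank_type // E doubleD.
Qed.

Lemma sum_card_components I : I \subset S ->
  \sum_(K in coxeter_components S) #|I :&: K| = #|I|.
Proof.
move=> /subsetP IS; rewrite -sum1_card.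
rewrite (partition_big (component S) (mem (coxeter_components S))) /=; last first.
  by move=> s sI; apply/component_in/IS.
apply: eq_bigr => K KC; rewrite -sum1_card; apply: eq_bigl => s.
rewrite inE; have [sI|//] := boolP (s \in I).
by have [_ ->] := mem_components KC; rewrite /= ?[K == _]eq_sym ?IS.
Qed.

Lemma color_rank_type x : (color_rank even_color_rank x).*2 = #|even_type x|.
Proof.
have [IS _ _] := even_typeP x; rewrite -(sum_card_components IS).
rewrite -muln2 /color_rank big_distrl [RHS]big_mkcond /=; apply: eq_bigr => K _.
rewrite muln2; case: ifP => KC; first exact: even_color_rank_type.
by rewrite /even_color_rank KC.
Qed.

Lemma colored_cover_card c x y : colored_cover even_color_rank c x y ->
  #|even_type y| = #|even_type x|.+2.
Proof.
have [IS _ _] := even_typeP x; have [JS _ _] := even_typeP y.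
move=> cxy; have cC := colored_cover_color cxy.
rewrite -(sum_card_components IS) -(sum_card_components JS).
rewrite (eq_bigr _ (fun K KC => colored_cover_type cxy KC)) big_split /=.
rewrite -addn2; congr addn; rewrite (bigD1 c) //= eqxx big1 // => K /andP[_ /negPf ->] //.
Qed.

Lemma colored_cover_add2 I g s t x y : I \subset S -> g \in <<S>> -> s \in S -> t \in S ->
  even_set I -> s \notin I -> t \notin s |: I -> even_set (t |: (s |: I)) ->
  x = <<I>> :^ g :> {set gT} -> y = <<t |: (s |: I)>> :^ g :> {set gT} ->
  colored_cover even_color_rank (component S s) x y.
Proof.
move=> IS gS sS tS eI sI tI eL xE yE; apply: colored_coverI.
  rewrite even_parabolic_leE xE yE conjSg genS //.
  by rewrite (subset_trans (subsetUr [set s] _)) // subsetUr.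
have LS : t |: (s |: I) \subset S by rewrite !subUset !sub1set sS tS.
move=> K; have [KC|KC] := boolP (K \in coxeter_components S); last first.
  rewrite /even_color_rank (negPf KC); case: eqVneq => // E.
  by rewrite E component_in in KC.
have [clK inK] := mem_components KC.
apply: double_inj; rewrite doubleD (even_color_rankE KC LS gS yE).
by rewrite (even_color_rankE KC IS gS xE) (card_even_add2 IS sS tS) // inK // addnC.
Qed.

Lemma even_le_align x y J h : (x <= y)%O -> J \subset S -> h \in <<S>> ->
  y = <<J>> :^ h :> {set gT} ->
  exists I g, [/\ I \subset J, even_set I, g \in <<J>> &
                  x = <<I>> :^ (g * h) :> {set gT}].
Proof.
have [IS eI [g gS xE]] := even_typeP x; rewrite even_parabolic_leE.
move=> + JS hW yE; rewrite xE yE => xy.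
have [d [b [dS bJ IdJ E]]] := parabolic_align hS IS JS gS hW xy.
by exists (even_type x :^ d), b; rewrite E; split=> //; apply: even_setJ.
Qed.

Lemma even_color_rank_mono x y K : (x <= y)%O -> even_color_rank x K <= even_color_rank y K.
Proof.
move=> xy; rewrite /even_color_rank; case: ifP => // KC; apply: half_leq.
have [IS eI [g gS xE]] := even_typeP x; have [JS eJ [h hW yE]] := even_typeP y.
have [clK _] := mem_components KC.
by apply: (parabolic_color_le hS IS JS clK gS hW); rewrite -xE -yE.
Qed.

Lemma even_color_rank_max x K : even_color_rank x K <= even_color_max K.
Proof.
rewrite /even_color_rank /even_color_max; case: ifP => // KC.
by rewrite half_leq // subset_leq_card // subsetIr.
Qed.

Lemma even_cover_below x y : (x < y)%O ->
  exists c a, colored_cover even_color_rank c x a /\ (a <= y)%O.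
Proof.
move=> xy; have [JS eJ [h hW yE]] := even_typeP y.
have [I [g [IJ eI gJ xE]]] := even_le_align (ltW xy) JS hW yE.
have IS := subset_trans IJ JS.
have gS : g \in <<S>> by apply: subsetP (genS JS) _ gJ.
have yE' : y = <<even_type y>> :^ (g * h) :> {set gT} by rewrite conjsgM (conjGid gJ).
have IneJ : I != even_type y.
  by apply: contraTneq xy => E; rewrite (even_parabolic_eq (x := x) (y := y)) ?ltxx // xE yE' E.
have [s [t [sJ tJ sI tI eL]]] := even_set_between IJ eI eJ IneJ.
have LJ : t |: (s |: I) \subset even_type y by rewrite !subUset !sub1set sJ tJ.
have ghS : g * h \in <<S>> by apply: groupM.
have [a aE] := exists_even_parabolic (subset_trans LJ JS) eL ghS.
exists (component S s), a; split; last first.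
  by rewrite even_parabolic_leE aE yE' conjSg genS.
by apply: colored_cover_add2 xE aE => //; apply: (subsetP JS).
Qed.

Lemma even_cover_exists x c : even_color_rank x c < even_color_max c ->
  exists a, colored_cover even_color_rank c x a.
Proof.
have [IS eI [g gS xE]] := even_typeP x.
move=> lt; have cC : c \in coxeter_components S.
  by move: lt; rewrite /even_color_max; case: ifP.
have [clc inc] := mem_components cC.
move: lt; rewrite -ltn_double even_color_rank_type // /even_color_max cC => lt.
set I := even_type x in IS eI xE lt *.
have {}lt : #|I :&: c|.+2 <= #|c|.
  (* An even number below twice the half of [#|c|] is at least two below [#|c|]. *)
  have := even_setI IS eI clc; move: lt; clear; move: #|_| #|_|; lia.
have [s sc sI] : exists2 s, s \in c & s \notin I.
  apply/exists_inP; apply: contraTT lt; rewrite negb_exists_in -ltnNge => /forall_inP h.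
  rewrite ltnS ltnW // ltnS subset_leq_card //; apply/subsetP=> s sc.
  by rewrite inE sc andbT; have := h _ sc; rewrite negbK.
have cS : c \subset S by case/edge_closedP: clc.
have sS := subsetP cS _ sc; have sIS : s |: I \subset S by rewrite subUset sub1set sS.
have cE : c = component S s by apply/eqP; rewrite -inc.
(* A closed component of [s] would contain all of [c], but it lies in [(s |: I) :&: c], which is too
   small. *)
have ncl : ~~ edge_closed S (component (s |: I) s).
  apply/negP=> cl; have := subset_leq_card (component_min cl (component_refl (setU11 s I))).
  rewrite -cE leqNgt => /negP[]; apply: leq_trans lt; rewrite ltnS.
  have -> : #|I :&: c|.+1 = #|(s |: I) :&: c| by rewrite card_setU1I // sc.
  apply/subset_leq_card/component_min; first exact: edge_closedI clc.
  by rewrite inE setU11.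
have [t [tS tI eL]] := even_set_extend IS eI sS sI ncl.
have LS : t |: (s |: I) \subset S by rewrite subUset sub1set tS.
have [a aE] := exists_even_parabolic LS eL gS.
by exists a; rewrite cE; apply: colored_cover_add2 xE aE.
Qed.

Lemma even_join_cover L h c c' z a b : L \subset S -> even_set L -> h \in <<S>> ->
  a \subset <<L>> :^ h -> b \subset <<L>> :^ h ->
  (forall K, K \in coxeter_components S ->
    #|L :&: K| + #|even_type z :&: K| = #|even_type a :&: K| + #|even_type b :&: K|) ->
  colored_cover even_color_rank c z a -> colored_cover even_color_rank c' z b ->
  exists w, [/\ w = <<L>> :^ h :> {set gT}, colored_cover even_color_rank c' a w &
                colored_cover even_color_rank c b w].
Proof.
move=> LS eL hW aL bL cL za zb; have [w wE] := exists_even_parabolic LS eL hW.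
have cC := colored_cover_color za; have c'C := colored_cover_color zb.
have key K : even_color_rank w K = even_color_rank z K + (K == c) + (K == c').
  have [KC|KC] := boolP (K \in coxeter_components S); last first.
    rewrite /even_color_rank (negPf KC).
    by rewrite !(negPf (contraNneq _ KC)) // => ->.
  apply: double_inj; rewrite (even_color_rankE KC LS hW wE).
  rewrite !doubleD even_color_rank_type //.
  have := cL _ KC; rewrite (colored_cover_type za KC) (colored_cover_type zb KC).
  by clear; lia.
have /colored_coverP[_ Ea] := za; have /colored_coverP[_ Eb] := zb.
exists w; split; [exact: wE | apply: colored_coverI | apply: colored_coverI].
- by rewrite even_parabolic_leE wE.
- by move=> K; rewrite key Ea.
- by rewrite even_parabolic_leE wE.
- by move=> K; rewrite key Eb addnAC.
Qed.

(** Apply [even_cover_join] inside [y], with its even type [J] in the role of [S]. Components of [J]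
    have even size, so the exceptional alternative cannot occur. *)
Lemma even_join_below c c' z a b y : colored_cover even_color_rank c z a ->
  colored_cover even_color_rank c' z b -> a != b -> (a <= y)%O -> (b <= y)%O ->
  exists w, [/\ (w <= y)%O, colored_cover even_color_rank c' a w &
                colored_cover even_color_rank c b w].
Proof.
move=> za zb ab ay by_; have /andP[/ltW lza _] := za; have /andP[/ltW lzb _] := zb.
have [JS eJ [h hW yE]] := even_typeP y; move: (even_type y) JS eJ yE => J JS eJ yE.
have [I0 [g0 [I0J eI0 g0J zE]]] := even_le_align (le_trans lza ay) JS hW yE.
have [I1 [g1 [I1J eI1 g1J aE]]] := even_le_align ay JS hW yE.
have [I2 [g2 [I2J eI2 g2J bE]]] := even_le_align by_ JS hW yE.
have sub1 : <<I0>> :^ g0 \subset <<I1>> :^ g1.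
  by move: lza; rewrite even_parabolic_leE zE aE !conjsgM conjSg.
have sub2 : <<I0>> :^ g0 \subset <<I2>> :^ g2.
  by move: lzb; rewrite even_parabolic_leE zE bE !conjsgM conjSg.
have neq : <<I1>> :^ g1 != <<I2>> :^ g2.
  by apply: contraNneq ab => E; apply/eqP/even_parabolic_eq; rewrite aE bE !conjsgM E.
have JW g : g \in <<J>> -> g * h \in <<S>>.
  by move=> gJ; rewrite groupM // (subsetP (genS JS)).
have typeE x I g K : I \subset J -> g \in <<J>> -> edge_closed S K ->
    x = <<I>> :^ (g * h) :> {set gT} -> #|I :&: K| = #|even_type x :&: K|.
  move=> IJ gJ clK xE; have [IS _ [k kS xE']] := even_typeP x.
  have IS' := subset_trans IJ JS.
  by apply: (parabolic_color_eq hS IS' IS clK (JW _ gJ) kS); rewrite -xE.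
have cardE x I g : I \subset J -> g \in <<J>> -> x = <<I>> :^ (g * h) :> {set gT} ->
    #|I| = #|even_type x|.
  move=> IJ gJ xE; have := typeE _ _ _ _ IJ gJ (edge_closed_refl S) xE.
  have [IS _ _] := even_typeP x.
  by rewrite (setIidPl (subset_trans IJ JS)) (setIidPl IS).
have c1 : #|I1| = #|I0|.+2.
  rewrite (cardE _ _ _ I0J g0J zE) (cardE _ _ _ I1J g1J aE).
  exact: colored_cover_card za.
have c2 : #|I2| = #|I0|.+2.
  rewrite (cardE _ _ _ I0J g0J zE) (cardE _ _ _ I2J g2J bE).
  exact: colored_cover_card zb.
have [[L [k [LJ eL kJ [aL bL] cL]]]|[K [KC oK _ _ _]]] :=
  even_cover_join (reflection_cocycleS JS hS) I0J I1J I2J eI0 eI1 eI2 g0J g1J g2J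
    sub1 sub2 c1 c2 neq; last first.
  by move/even_setP/forall_inP: eJ => /(_ _ KC); rewrite oK.
have [||K KC|w [wE aw bw]] := even_join_cover (subset_trans LJ JS) eL (JW _ kJ) _ _ _ za zb.
- by rewrite aE !conjsgM conjSg.
- by rewrite bE !conjsgM conjSg.
- have [clK _] := mem_components KC.
  rewrite -(typeE _ _ _ _ I0J g0J clK zE) -(typeE _ _ _ _ I1J g1J clK aE).
  rewrite -(typeE _ _ _ _ I2J g2J clK bE).
  have JK (I : {set gT}) : I \subset J -> I :&: K = I :&: (J :&: K).
    by move=> IJ; rewrite setIA (setIidPl IJ).
  by rewrite (JK L) // (JK I0) // (JK I1) // (JK I2) // (cL _ (edge_closedI JS clK)).
exists w; split=> //; rewrite even_parabolic_leE wE yE conjsgM conjSg.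
by rewrite -(conjGid kJ) conjSg genS.
Qed.

Lemma even_join c c' z a b : colored_cover even_color_rank c z a ->
  colored_cover even_color_rank c' z b -> a != b ->
  (exists w, colored_cover even_color_rank c' a w /\ colored_cover even_color_rank c b w) \/
  (c = c' /\ even_color_rank a c = even_color_max c).
Proof.
move=> za zb ab.
have [I0S eI0 [g0 g0S zE]] := even_typeP z; have [I1S eI1 [g1 g1S aE]] := even_typeP a.
have [I2S eI2 [g2 g2S bE]] := even_typeP b.
have /colored_coverP[/ltW sub1 Ea] := za; have /colored_coverP[/ltW sub2 Eb] := zb.
rewrite even_parabolic_leE zE aE in sub1.
rewrite even_parabolic_leE zE bE in sub2.
have neq : <<even_type a>> :^ g1 != <<even_type b>> :^ g2.
  by apply: contraNneq ab => E; apply/eqP/even_parabolic_eq; rewrite aE bE.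
have [[L [h [LS eL hW [aL bL] cL]]]|[K [KC oK c1 c2 c0]]] :=
  even_cover_join hS I0S I1S I2S eI0 eI1 eI2 g0S g1S g2S sub1 sub2
    (colored_cover_card za) (colored_cover_card zb) neq.
  left; rewrite -aE in aL; rewrite -bE in bL.
  have [|w [_ aw bw]] := even_join_cover LS eL hW aL bL _ za zb; last by exists w.
  by move=> K /mem_components[clK _]; apply: cL.
(* Both covers raise the rank in the exceptional component [K], so it is the color of each. *)
have := colored_cover_type za KC; have := colored_cover_type zb KC.
case: (eqVneq K c') => [E _|_]; last by rewrite -c0 => /eqP; rewrite addn0 -[X in _ == X]addn0 -addn2 eqn_add2l.
case: (eqVneq K c) => [E' _|_]; last first.
  move: c1 c2 c0; clear; lia.
right; split; first by rewrite -E.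
(* As [#|K|] is odd, filling [K] up to one generator attains the maximum [#|K|./2]. *)
rewrite /even_color_max -E' KC; apply: double_inj; rewrite even_color_rank_type //.
by move: c1 oK; clear; lia.
Qed.

(** Outside the component [c'], passing from [a] to [w] adds no rank, so [a] contains that part of
    [w]. Since [c] differs from [c'], [b] contains the part inside [c']. So every generator of [w]
    lies in [w']. *)
Lemma even_join_unique_sub c c' a b w w' : c != c' ->
  colored_cover even_color_rank c' a w -> colored_cover even_color_rank c b w ->
  (a <= w')%O -> (b <= w')%O -> (w <= w')%O.
Proof.
move=> cc' aw bw aw' bw'.
have [LS eL [h hW wE]] := even_typeP w.
have [I1S eI1 [g1 g1S aE]] := even_typeP a; have [I2S eI2 [g2 g2S bE]] := even_typeP b.
have /andP[/ltW aw_ _] := aw; have /andP[/ltW bw_ _] := bw.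
rewrite even_parabolic_leE aE wE in aw_.
rewrite even_parabolic_leE bE wE in bw_.
rewrite even_parabolic_leE wE -genJ gen_subG.
apply/subsetP=> _ /imsetP[s sL ->]; have sS := subsetP LS _ sL.
have KC := component_in sS; have [clK _] := mem_components KC.
have sLK : s ^ h \in <<even_type w :&: component S s>> :^ h.
  by rewrite memJ_conjg mem_gen // inE sL component_refl.
have := colored_cover_type aw KC; have := colored_cover_type bw KC.
have [E|_] := eqVneq (component S s) c'; last first.
  move=> _; rewrite addn0 => /esym Ew; apply: (subsetP aw'); rewrite aE.
  exact: (subsetP (parabolic_color_part hS I1S LS clK g1S hW aw_ Ew)).
rewrite E eq_sym (negPf cc') -E addn0 => /esym Ew _; apply: (subsetP bw'); rewrite bE.
exact: (subsetP (parabolic_color_part hS I2S LS clK g2S hW bw_ Ew)).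
Qed.

Lemma even_color_graded : @color_graded _ T _ even_color_rank even_color_max.
Proof.
split; [exact: even_color_rank_mono|exact: even_color_rank_max|exact: even_cover_below
  |exact: even_cover_exists|exact: even_join_below|exact: even_join|].
move=> c c' z a b w w' cc' _ _ aw bw aw' bw'.
have le x y k : colored_cover even_color_rank k x y -> (x <= y)%O by case/andP=> /ltW.
apply/le_anti/andP; split.
  by apply: (even_join_unique_sub cc' aw bw); [apply: le aw'|apply: le bw'].
by apply: (even_join_unique_sub cc' aw' bw'); [apply: le aw|apply: le bw].
Qed.

Lemma even_color_rank_bot : color_rank even_color_rank (\bot%O : T) = 0.
Proof.
apply: double_inj; rewrite color_rank_type; apply/eqP; rewrite double0 cards_eq0.
have [IS _ [g gS E]] := even_typeP (\bot%O : T).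
apply/eqP/setP=> s; rewrite inE; apply/negP=> sI.
have : s ^ g \in (\bot%O : T) by rewrite E memJ_conjg mem_gen.
move/set1P/eqP; rewrite conjg_eq1; apply/negP.
exact: (gen_neq1 hS (subsetP IS _ sI)).
Qed.

Lemma even_parabolic_has_rank x r : has_parabolic_rank W S x r ->
  ~~ odd r /\ has_poset_rank x r./2.
Proof.
case=> I /andP[IS /imsetP[g gW xE]] <-; rewrite -genW in gW.
have [JS eJ [h hW xE']] := even_typeP x.
have -> : #|I| = #|even_type x|.
  have := parabolic_color_eq hS IS JS (edge_closed_refl S) gW hW.
  by rewrite -xE -xE' (setIidPl IS) (setIidPl JS) => ->.
split; first exact: even_set_card.
move=> C /(maximal_chain_interval_card even_color_graded (le0x x)) E.
by rewrite /chain_length E -color_rank_type doubleK even_color_rank_bot subn0.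
Qed.

Lemma irreducible_components : coxeter_irreducible S -> coxeter_components S = [set S].
Proof.
case/cards1P=> K E; rewrite E; congr [set _].
have : K \in coxeter_components S by rewrite E set11.
rewrite coxeter_componentsE => /imsetP[t tS KE]; apply/eqP.
rewrite eqEsubset {1}KE; apply/andP; split; first by case/edge_closedP: (component_closed S t).
apply/subsetP=> s sS; have := component_in sS; rewrite E => /set1P <-.
exact: component_refl.
Qed.

Lemma even_parabolic_semimodular : coxeter_irreducible S -> ~~ odd #|S| ->
  semimodular T.
Proof.
move=> irr eS; have evS : even_set S.
  by apply/even_setP/forall_inP=> K; rewrite irreducible_components // => /set1P ->.
(* The whole group is itself an even parabolic subgroup and serves as the maximum. *)
have [t tE] := exists_even_parabolic (subxx S) evS (group1 _).
apply: (color_graded_semimodular even_color_graded (b := \bot%O) (t := t)) => x.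
  exact: le0x.
have [IS _ [g gS xE]] := even_typeP x.
by rewrite even_parabolic_leE tE xE conjsg1 -(conjGid gS) conjSg genS.
Qed.

Lemma even_parabolic_with_top_semimodular : coxeter_irreducible S ->
  semimodular (with_top T).
Proof.
move=> irr; apply: (color_graded_with_top_semimodular even_color_graded (b := \bot%O) (c0 := S)).
  exact: le0x.
by move=> K KS; rewrite /even_color_max irreducible_components // inE (negPf KS).
Qed.

End EvenParabolics.

Theorem theorem1p5 (gT : finGroupType) (W : {group gT}) (S : {set gT})
    (hW : coxeter_system W S) :
  [/\ pure_poset (even_parabolic_poset W S) /\
      (forall (P : even_parabolic_poset W S) (r : nat),
         has_parabolic_rank W S P r -> ~~ odd r /\ has_poset_rank P r./2),
      (coxeter_irreducible S -> ~~ odd #|S| ->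
         semimodular (even_parabolic_poset W S)) /\
      (coxeter_irreducible S -> odd #|S| ->
         semimodular (with_top (even_parabolic_poset W S)))
    & cohen_macaulay (even_parabolic_poset W S)].
Proof.
have genW : <<S>>%g = W by case: hW.
have [eta hS] := coxeter_cocycle hW.
have gr := even_color_graded hS genW.
split; [split|split|].
- exact: (color_graded_pure gr (@Order.le0x _ _)).
- by move=> P r; apply: even_parabolic_has_rank hS genW _ _.
- exact: even_parabolic_semimodular hS genW.
- by move=> irr _; apply: even_parabolic_with_top_semimodular hS genW irr.
- exact: (color_graded_cohen_macaulay gr (@Order.le0x _ _)).
Qed.
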